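(* Let $R=k[x_0,\ldots,x_n]$ be a polynomial ring over a field $k$ of any characteristic, let $1\le c<s$ be integers, and let $\mathcal F=\{F_1,\ldots,F_s\}$ be a set of $s$ forms in $R$ such that any $c+1$ of them form a regular sequence. Let $I_c=\bigcap_{1\le j_1<\cdots<j_c\le s}(F_{j_1},\ldots,F_{j_c})$. Assume all forms in $\mathcal F$ have degree $\delta\ge 1$. Then: (1) For any fixed $m\ge 1$, the ideal $I_c^{(m)}$ has only (minimal) generators in degrees $\delta(t(s-c)+m)$, where $\lceil \frac mc\rceil\le t\le m$. (2) For every fixed $m\ge 1$ and $t$ with $\lceil\frac mc\rceil\le t\le m$, the number of (minimal) generators of $I_c^{(m)}$ of degree $\delta(t(s-c)+m)$ is $$\sum_{B=\{b_1,\ldots,b_h\}\subseteq[c]}\left(|\mathbb S_{t,B}|\binom{s}{c-b_h}\binom{s-c+b_h}{b_h-b_{h-1}}\binom{s-c+b_{h-1}}{b_{h-1}-b_{h-2}}\cdots\binom{s-c+b_2}{b_2-b_1}\right),$$ where $\mathbb S_{t,B}$ is the set of all distinct positive solutions to the system of Diophantine equations $$b_1x_1+b_2x_2+\cdots+b_hx_h=m,\qquad x_1+x_2+\cdots+x_h=t.$$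
   Context: For a homogeneous ideal $I\subseteq R$ and $m\ge 1$, the symbolic power is $I^{(m)}=\bigcap_{P\in \mathrm{Ass}(R/I)}(I^mR_P\cap R)$. $[c]=\{1,2,\ldots,c\}$; the sum runs over the nonempty subsets $B\subseteq [c]$, whose elements are always written in increasing order, $1\le b_1<b_2<\cdots<b_h\le c$. A positive solution is an ordered tuple $(x_1,\ldots,x_h)$ of positive integers satisfying the equations. When $h=1$ the product of binomials is just $\binom{s}{c-b_1}$. *)

(* Defs.v *)
From mathcomp Require Import all_boot all_order all_algebra.
From mathcomp Require Export mpoly.

Set Implicit Arguments.
Unset Strict Implicit.
Unset Printing Implicit Defensive.

Import Order.TTheory GRing.Theory Num.Theory.
Local Open Scope ring_scope.
Local Notation "x %:F" := (FracField.tofrac x).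

(* Ideals need not be decidable, so subsets of a ring are predicates
   R -> Prop. *)

Definition ideal_gen (R : comNzRingType) (S : R -> Prop) : R -> Prop :=
  fun x => exists2 e : seq (R * R),
    (forall p, p \in e -> S p.2) & x = \sum_(p <- e) p.1 * p.2.

Definition ideal_span (R : comNzRingType) (G : seq R) : R -> Prop :=
  ideal_gen (fun x => x \in G).

Definition ideal_power (R : comNzRingType) (I : R -> Prop) (m : nat) :
    R -> Prop :=
  ideal_gen (fun x => exists2 a : 'I_m -> R,
    (forall i, I (a i)) & x = \prod_(i < m) a i).

Definition is_ideal (R : comNzRingType) (I : R -> Prop) : Prop :=
  [/\ I 0, (forall x y, I x -> I y -> I (x + y))
    & (forall r x, I x -> I (r * x))].

Definition is_prime_ideal (R : comNzRingType) (P : R -> Prop) : Prop :=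
  [/\ is_ideal P, ~ P 1 & (forall x y, P (x * y) -> P x \/ P y)].

(* P is the annihilator of the class of some x in R / I. *)
Definition associated_prime (R : comNzRingType) (I P : R -> Prop) : Prop :=
  is_prime_ideal P /\ exists x : R, forall r, P r <-> I (r * x).

(* For a domain R, the localization R_P is taken inside the fraction field. *)
Definition localization (R : idomainType) (P : R -> Prop) :
    {fraction R} -> Prop :=
  fun x => exists a g : R,
    ~ P g /\ x = a%:F / g%:F.

(* The extended ideal I R_P. *)
Definition extended_ideal (R : idomainType) (P I : R -> Prop) :
    {fraction R} -> Prop :=
  fun x => exists2 e : seq ({fraction R} * R),
    (forall p, p \in e -> localization P p.1 /\ I p.2)
    & x = \sum_(p <- e) p.1 * p.2%:F.

Definition symbolic_power (R : idomainType) (I : R -> Prop) (m : nat) :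
    R -> Prop :=
  fun f => forall P : R -> Prop, associated_prime I P ->
    extended_ideal P (ideal_power I m) f%:F.

Definition regular_sequence (R : comNzRingType) (r : seq R) : Prop :=
  (forall i, (i < size r)%N -> forall f : R,
     ideal_span (take i r) (f * r`_i) -> ideal_span (take i r) f)
  /\ ~ ideal_span r 1.

(* I_c, the intersection of the ideals (F_j : j in J) over all J of size c. *)
Definition star_ideal (R : comNzRingType) (s : nat) (F : 'I_s -> R) (c : nat) :
    R -> Prop :=
  fun f => forall J : {set 'I_s}, #|J| = c ->
    ideal_span [seq F j | j <- enum J] f.

(* An inclusion-minimal set of homogeneous generators; minimality forces G to
   be duplicate-free and without 0, so counting entries counts generators and
   each generator has a unique degree. *)
Definition minimal_generators (k : fieldType) (n : nat)
    (I : {mpoly k[n]} -> Prop) (G : seq {mpoly k[n]}) : Prop :=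
  [/\ (forall g, g \in G -> exists d, g \is d.-homog),
      (forall f, I f <-> ideal_span G f)
    & (forall G', subseq G' G -> (forall f, I f <-> ideal_span G' f) ->
         G' = G)].

Definition generated_in_degrees (k : fieldType) (n : nat)
    (I : {mpoly k[n]} -> Prop) (D : nat -> Prop) : Prop :=
  (exists G, minimal_generators I G) /\
  forall G, minimal_generators I G ->
    forall g, g \in G -> exists2 d, D d & g \is d.-homog.

Definition number_of_generators (k : fieldType) (n : nat)
    (I : {mpoly k[n]} -> Prop) (d N : nat) : Prop :=
  (exists G, minimal_generators I G) /\
  forall G, minimal_generators I G ->
    count (fun g => g \is d.-homog) G = N.

(* ceil (m / c) <= t <= m *)
Definition t_range (m c t : nat) : Prop :=
  (Num.ceil (m%:Q / c%:Q) <= t%:Z) /\ (t <= m)%N.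

Local Open Scope nat_scope.

(* A subset of [c] = {1, ..., c} is encoded as B : {set 'I_c}, where i stands
   for i.+1; enum lists 'I_c in increasing order, so the result is
   [:: b_1; ...; b_h] with b_1 < ... < b_h. *)
Definition elements (c : nat) (B : {set 'I_c}) : seq nat :=
  [seq (val i).+1 | i <- enum B].

(* The entries of a positive solution have sum t, so they are at most t and
   nothing is lost by taking them in 'I_t.+1 (see mem_positive_solutions). *)
Definition positive_solutions (m t : nat) (b : seq nat) :
    {set (size b).-tuple 'I_t.+1} :=
  [set x : (size b).-tuple 'I_t.+1 |
    [&& [forall i, 0 < tnth x i],
        \sum_(i < size b) nth 0 b i * tnth x i == m
      & \sum_(i < size b) tnth x i == t]].

Lemma mem_positive_solutions (m t : nat) (b : seq nat)
    (x : (size b).-tuple nat) :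
  (forall i, 0 < tnth x i) ->
  \sum_(i < size b) nth 0 b i * tnth x i = m ->
  \sum_(i < size b) tnth x i = t ->
  exists2 y, y \in positive_solutions m t b & forall i, tnth x i = tnth y i.
Proof.
move=> x_gt0 xm xt.
have x_le i : tnth x i < t.+1.
  by rewrite ltnS -xt (bigD1 i) //= leq_addr.
have yE i : tnth x i = tnth [tuple inord (tnth x i) : 'I_t.+1 | i < size b] i.
  by rewrite tnth_mktuple inordK.
exists [tuple inord (tnth x i) : 'I_t.+1 | i < size b] => //.
rewrite inE; apply/and3P; split.
- by apply/forallP => i; rewrite -yE.
- by rewrite -xm; apply/eqP/eq_bigr => i _; rewrite -yE.
- by apply/eqP; rewrite -[RHS]xt; apply: eq_bigr => i _; rewrite -yE.
Qed.

(* 'C(s, c - b_h) * prod_(2 <= i <= h) 'C(s - c + b_i, b_i - b_(i-1)). *)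
Definition binomial_product (s c : nat) (b : seq nat) : nat :=
  'C(s, c - last 0 b) *
  \prod_(1 <= i < size b) 'C(s - c + nth 0 b i, nth 0 b i - nth 0 b i.-1).

(* Main.v *)
Require Import Defs.
From mathcomp Require Import all_boot all_order all_algebra.
From mathcomp Require Import mpoly.
From mathcomp Require Import ring zify.
From Stdlib Require Import Classical ClassicalEpsilon.

Set Implicit Arguments.
Unset Strict Implicit.
Unset Printing Implicit Defensive.

Import Order.TTheory GRing.Theory Num.Theory.
Local Open Scope ring_scope.

(** Write F^a for the product of the F_j^(a_j), F_J for the ideal generated by
    the F_j with j in J, and put r = s - c. The idea is that the symbolic power
    I_c^(m) behaves as if the F_j were independent variables: it is generated by
    the F^a such that a sums to at least m over every c-subset J, and the
    minimal such a give the minimal generators, although the map from a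
    polynomial ring in s variables that sends y_j to F_j is far from flat when
    s > c + 1.

    Everything about the forms enters through one colon computation,
    [power_ideal_colon]: for #|J| <= c, if q F^a lies in the ideal of the
    F_j^(a_j + 1), j in J, then q lies in F_J. It says that the monomial F^a can
    be separated from all the monomials whose exponent exceeds a somewhere on J,
    and it holds because any c + 1 of the F_j form a regular sequence in every
    order.

    Localizing at an associated prime of R / I_c inverts the F_l with l outside
    some c-subset J, so F^a belongs to the symbolic power as soon as a sums to at
    least m over every c-subset ([symbolic_star_monomial]). Conversely, for f in
    the symbolic power and #|J| = c, the multipliers g with g f in F_J^m are
    contained in no prime associated to F_J, since such a prime is also
    associated to I_c. If f = sum_w R_w F^w + (larger monomials), the colon
    computation puts g R_w in F_J for all those g, hence R_w in F_J, and F^w is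
    replaced by larger monomials; running through the monomials in increasing
    order proves [symbolic_star_sub]. The existence of associated primes is
    Hilbert's basis theorem, proved from Dickson's lemma ([ex_prime_colon]).

    The minimal exponents are those bounded by some t, equal to t in more than r
    places, and of sum t r + m ([minimal_exponent]). Such an a is exceeded on a
    suitable c-subset J by every other minimal exponent
    ([minimal_exponent_exceeds]), so the colon computation shows once more that
    in a relation between the minimal monomials all coefficients lie in ideals
    F_J ([star_relation]), in particular have constant term 0. By the graded
    Nakayama argument ([leq_count_homog]) every minimal generating set then has
    as many elements of each degree as this one, and F^a has degree
    delta (t r + m).

    To count the minimal exponents with given t, let S_i be the set of the j
    with a_j >= i. This is a decreasing chain of t sets of sizes r + b with
    1 <= b <= c, and the numbers b sum to m. Both the number of chains and the
    sum over B satisfy the recursion obtained by splitting off S_1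
    ([chain_countS], [card_level_exponents]). *)

(** * Ideals as predicates *)

Section Ideals.
Variable R : comNzRingType.
Implicit Types (S I : R -> Prop) (x y : R).

Lemma ideal_gen_ideal S : is_ideal (ideal_gen S).
Proof.
split.
- by exists [::] => //; rewrite big_nil.
- move=> x y [ex exS ->] [ey eyS ->].
  exists (ex ++ ey); last by rewrite big_cat.
  by move=> p; rewrite mem_cat => /orP[/exS|/eyS].
- move=> r x [e eS ->]; exists [seq (r * p.1, p.2) | p <- e].
    by move=> _ /mapP[q qe ->]; apply: (eS q).
  by rewrite big_map mulr_sumr; apply: eq_bigr => p _; rewrite mulrA.
Qed.

Lemma ideal_gen_mem S x : S x -> ideal_gen S x.
Proof.
move=> Sx; exists [:: (1, x)]; last by rewrite big_seq1 mul1r.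
by move=> p; rewrite inE => /eqP->.
Qed.

Lemma is_ideal_sum I (T : Type) (l : seq T) (P : pred T) (f : T -> R) :
  is_ideal I -> (forall i, P i -> I (f i)) -> I (\sum_(i <- l | P i) f i).
Proof. by case=> I0 ID _ If; apply: big_ind. Qed.

(** The induction principle for [ideal_gen]: most statements on a generated ideal
    below are proved by exhibiting an ideal that contains the generators, so
    that explicit linear combinations never appear. *)
Lemma ideal_gen_min S I x :
  is_ideal I -> (forall y, S y -> I y) -> ideal_gen S x -> I x.
Proof.
move=> idI SI [e eS ->]; rewrite big_seq; apply: is_ideal_sum => // p /eS/SI Ip.
by case: idI => _ _; apply.
Qed.

Lemma ideal_gen_mono S S' x :
  (forall y, S y -> ideal_gen S' y) -> ideal_gen S x -> ideal_gen S' x.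
Proof. by apply: ideal_gen_min; apply: ideal_gen_ideal. Qed.

Lemma is_idealM I r x : is_ideal I -> I x -> I (r * x).
Proof. by case=> _ _; apply. Qed.

Lemma is_idealMr I r x : is_ideal I -> I x -> I (x * r).
Proof. by rewrite mulrC; apply: is_idealM. Qed.

Lemma is_idealD I x y : is_ideal I -> I x -> I y -> I (x + y).
Proof. by case=> _ ID _; apply: ID. Qed.

Lemma is_idealN I x : is_ideal I -> I x -> I (- x).
Proof. by move=> idI Ix; rewrite -mulN1r; apply: is_idealM. Qed.

Lemma is_idealB I x y : is_ideal I -> I x -> I y -> I (x - y).
Proof. by move=> idI Ix Iy; apply: is_idealD => //; apply: is_idealN. Qed.

Lemma is_ideal0 I : is_ideal I -> I 0.
Proof. by case. Qed.

Lemma colon_ideal I y : is_ideal I -> is_ideal (fun r => I (r * y)).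
Proof.
move=> idI; split=> [|r q Ir Iq|r q Iq]; rewrite ?mul0r ?mulrDl -?mulrA.
- exact: is_ideal0.
- exact: is_idealD.
- exact: is_idealM.
Qed.

End Ideals.

(** * Monomials in a permutable regular family *)

Section PowerIdeals.
Variables (R : comNzRingType) (s : nat) (F : 'I_s -> R).
Implicit Types (T J K : {set 'I_s}) (a b : 'I_s -> nat).

Definition monomial a : R := \prod_j F j ^+ a j.

Definition power_ideal T a : R -> Prop :=
  ideal_gen (fun x => exists2 j, j \in T & x = F j ^+ a j).

Definition face_ideal T := power_ideal T (fun => 1%N).

Lemma power_idealP T a : is_ideal (power_ideal T a).
Proof. exact: ideal_gen_ideal. Qed.

Lemma face_idealP T : is_ideal (face_ideal T).
Proof. exact: power_idealP. Qed.

Hint Resolve power_idealP face_idealP : core.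

Lemma monomialD a b :
  monomial (fun j => a j + b j)%N = monomial a * monomial b.
Proof. by rewrite -big_split; apply: eq_bigr => j _; rewrite exprD. Qed.

Lemma eq_monomial a b : a =1 b -> monomial a = monomial b.
Proof. by move=> ab; apply: eq_bigr => j _; rewrite ab. Qed.

Lemma monomial1 j : monomial (fun l => (l == j) : nat) = F j.
Proof.
rewrite /monomial (bigD1 j) //= eqxx expr1 big1 ?mulr1 // => l /negbTE->.
by rewrite expr0.
Qed.

Lemma monomial_le a b : (forall j, a j <= b j)%N ->
  monomial b = monomial (fun j => b j - a j)%N * monomial a.
Proof.
by move=> ab; rewrite -monomialD; apply: eq_monomial => j; rewrite subnK.
Qed.

Lemma power_ideal_gen T a j : j \in T -> power_ideal T a (F j ^+ a j).
Proof. by move=> jT; apply: ideal_gen_mem; exists j. Qed.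

Lemma face_ideal_gen T j : j \in T -> face_ideal T (F j).
Proof. by rewrite -[F j]expr1; apply: power_ideal_gen. Qed.

Lemma power_ideal_sub T T' a a' z : T \subset T' ->
  {in T, forall j, (a' j <= a j)%N} -> power_ideal T a z -> power_ideal T' a' z.
Proof.
move=> sTT' le_a; apply: ideal_gen_mono => _ [j jT ->].
rewrite -/(power_ideal _ _ _) -(subnK (le_a _ jT)) exprD.
apply: is_idealM => //.
by apply: power_ideal_gen; apply: (subsetP sTT').
Qed.

Lemma power_ideal_monomial T a b j :
  j \in T -> (a j <= b j)%N -> power_ideal T a (monomial b).
Proof.
move=> jT le_ab; rewrite /monomial (bigD1 j) //=; apply: is_idealMr => //.
by rewrite -(subnK le_ab) exprD; apply: is_idealM => //; apply: power_ideal_gen.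
Qed.

Lemma power_ideal_split T a i z : i \in T -> power_ideal T a z ->
  exists r, power_ideal (T :\ i) a (z - r * F i ^+ a i).
Proof.
move=> iT.
pose I y := exists r, power_ideal (T :\ i) a (y - r * F i ^+ a i).
apply: (@ideal_gen_min _ _ I) => [|_ [j jT ->]]; first split; rewrite /I.
- by exists 0; rewrite mul0r subr0; apply: is_ideal0.
- move=> x y [r Hr] [q Hq]; exists (r + q).
  have -> : x + y - (r + q) * F i ^+ a i =
    (x - r * F i ^+ a i) + (y - q * F i ^+ a i) by ring.
  exact: is_idealD.
- move=> q x [r Hr]; exists (q * r).
  by rewrite -mulrA -mulrBr; apply: is_idealM.
- case: (eqVneq j i) => [->|ji].
    by exists 1; rewrite mul1r subrr; apply: is_ideal0.
  exists 0; rewrite mul0r subr0; apply: power_ideal_gen.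
  by rewrite !inE ji jT.
Qed.

Lemma power_ideal_join T a i z r : i \in T ->
  power_ideal (T :\ i) a (z - r * F i ^+ a i) -> power_ideal T a z.
Proof.
move=> iT Hz; rewrite -(subrK (r * F i ^+ a i) z); apply: is_idealD => //.
  by apply: power_ideal_sub Hz => //; apply: subsetDl.
by apply: is_idealM => //; apply: power_ideal_gen.
Qed.

(** When every set of at most [c + 1] of the [F j] is a regular sequence, it is
    one in every order; this is the form in which that is used. *)
Definition permutable_regular c := forall T i z,
  (#|T| <= c)%N -> i \notin T -> face_ideal T (z * F i) -> face_ideal T z.

Variable c : nat.
Hypothesis regF : permutable_regular c.

(** Induction on the sum of the exponents. If some [a j > 1], lower it by one:
    [z] lies in the larger ideal by induction, so [z = r F_j^(a_j - 1)] modulo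
    the other generators. Cancelling [F_j^(a_j - 1)], which is regular modulo
    those, reduces the hypothesis to one on [r] with the exponent of [F_j] equal
    to 1, again covered by induction. *)
Lemma power_ideal_regular T a i z :
  (#|T| <= c)%N -> i \notin T -> {in T, forall j, (0 < a j)%N} ->
  power_ideal T a (z * F i) -> power_ideal T a z.
Proof.
have [N] := ubnP (\sum_(j in T) a j).
elim: N => // N IH in T a i z *; rewrite ltnS => ltN Tc iT a_gt0 Hz.
case: (boolP [forall j in T, a j == 1]%N) => [/forall_inP a1|].
  apply: (@power_ideal_sub T T (fun => 1%N)).
  - exact: subxx.
  - by move=> j /a1/eqP->.
  - by apply: (regF (i := i)) => //; apply: power_ideal_sub Hz.
move=> /forall_inPn[j jT aj_n1].
have aj_gt1 : (1 < a j)%N by rewrite ltn_neqAle eq_sym aj_n1 a_gt0.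
have ij : j != i by apply: contraNneq iT => <-.
have sumT (b : 'I_s -> nat) : (\sum_(l in T) b l =
    b j + \sum_(l in T :\ j) b l)%N.
  rewrite (bigD1 j) //=; congr addn; apply: eq_bigl => l.
  by rewrite !inE andbC.
pose upd k l := if l == j then k else a l.
have updj k : upd k j = k by rewrite /upd eqxx.
have upd_sum k : (\sum_(l in T :\ j) upd k l = \sum_(l in T :\ j) a l)%N.
  by apply: eq_bigr => l; rewrite !inE /upd => /andP[/negbTE->].
have updT k T' w :
    power_ideal (T' :\ j) (upd k) w <-> power_ideal (T' :\ j) a w.
  by split; apply: power_ideal_sub => // l;
    rewrite !inE /upd => /andP[/negbTE->].
have upd_gt0 k : (0 < k)%N -> {in T, forall l, (0 < upd k l)%N}.
  by move=> k0 l lT; rewrite /upd; case: eqP => // _; apply: a_gt0.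
have TjC : (#|T :\ j| <= c)%N.
  by apply: leq_trans Tc; apply: subset_leq_card; apply: subsetDl.
have jTj : j \notin T :\ j by rewrite !inE eqxx.
have IHj n w :
    power_ideal (T :\ j) a (w * F j ^+ n) -> power_ideal (T :\ j) a w.
  elim: n w => [|n IHn] w; first by rewrite mulr1.
  rewrite exprSr mulrA => /IH H; apply: IHn; apply: H => //.
    by apply: leq_trans ltN; rewrite sumT; lia.
  by move=> l; rewrite !inE => /andP[_]; apply: a_gt0.
(* Lowering [a j] to [(a j).-1] determines [z] up to a multiple of
   [F j ^+ (a j).-1]. *)
have H1 : power_ideal T (upd (a j).-1) z.
  apply: (IH _ _ i) => //; last 2 first.
  - by apply: upd_gt0; lia.
  - apply: power_ideal_sub Hz => // l lT; rewrite /upd; case: eqP => // ->.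
    exact: leq_pred.
  - by apply: leq_trans ltN; rewrite !sumT updj upd_sum; lia.
have [r] := power_ideal_split jT H1; rewrite updj => /updT Hr.
have [r2 Hr2] := power_ideal_split jT Hz.
have H2 : power_ideal (T :\ j) a (r * F i - r2 * F j).
  apply: (IHj (a j).-1).
  have ajE : F j ^+ a j = F j * F j ^+ (a j).-1.
    by rewrite -exprS prednK // ltnW.
  have -> : (r * F i - r2 * F j) * F j ^+ (a j).-1 =
    (z * F i - r2 * F j ^+ a j) - (z - r * F j ^+ (a j).-1) * F i.
    by rewrite ajE; ring.
  by apply: is_idealB => //; apply: is_idealMr.
have H3 : power_ideal T (upd 1%N) r.
  apply: (IH _ _ i) => //.
  - by apply: leq_trans ltN; rewrite !sumT updj upd_sum; lia.
  - exact: upd_gt0.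
  - apply: (@power_ideal_join _ _ j _ r2) => //; rewrite updj expr1.
    exact/updT.
have [r3] := power_ideal_split jT H3; rewrite updj expr1 => /updT Hr3.
apply: (@power_ideal_join _ _ j _ r3) => //.
have -> : z - r3 * F j ^+ a j =
  (z - r * F j ^+ (a j).-1) + (r - r3 * F j) * F j ^+ (a j).-1.
  have -> : F j ^+ a j = F j * F j ^+ (a j).-1.
    by rewrite -exprS prednK // ltnW.
  by ring.
by apply: is_idealD => //; apply: is_idealMr.
Qed.

Lemma power_ideal_regularX T a i n z :
  (#|T| <= c)%N -> i \notin T -> {in T, forall j, (0 < a j)%N} ->
  power_ideal T a (z * F i ^+ n) -> power_ideal T a z.
Proof.
move=> Tc iT a0; elim: n z => [|n IHn] z; first by rewrite mulr1.
by rewrite exprSr mulrA => /power_ideal_regular H; apply/IHn/H.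
Qed.

Lemma power_ideal_regular_prod T a e z :
  (#|T| <= c)%N -> {in T, forall j, (0 < a j)%N} ->
  power_ideal T a (z * \prod_(j | j \notin T) F j ^+ e j) ->
  power_ideal T a z.
Proof.
move=> Tc a0.
apply: (big_rec (fun p => power_ideal T a (z * p) -> power_ideal T a z)).
  by rewrite mulr1.
move=> i p iT IH; rewrite [_ ^+ _ * p]mulrC mulrA => H; apply: IH.
exact: power_ideal_regularX Tc iT a0 H.
Qed.

(** Factors [F_i] with [i] outside [J] cancel because they are regular modulo the
    powers. For [i] in [J], [q F_i^(a_i) = r F_i^(a_i + 1)] modulo the other
    generators gives [q - r F_i = 0] modulo them: the exponent of [F_i] in the
    ideal drops from [a_i + 1] to 1. Doing this for all of [J] leaves [F_J]. *)
Lemma power_ideal_colon J a z : (#|J| <= c)%N ->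
  power_ideal J (fun j => (a j).+1) (z * monomial a) -> face_ideal J z.
Proof.
move=> Jc; rewrite /monomial (bigID (mem J)) /= mulrA.
move/power_ideal_regular_prod => /(_ Jc (fun _ _ => isT)) Hz.
(* [K] is the set of the indices that remain to be treated. *)
pose ex K j := if j \in K then (a j).+1 else 1%N.
have ex_gt0 K j : (0 < ex K j)%N by rewrite /ex; case: ifP.
suff main K : K \subset J ->
    power_ideal J (ex K) (z * \prod_(j in K) F j ^+ a j) -> face_ideal J z.
  apply: (main J) => //.
  by apply: power_ideal_sub Hz => // j jJ; rewrite /ex jJ.
have [N] := ubnP #|K|; elim: N => // N IH in K *; rewrite ltnS => KN sKJ.
have [->|[i iK]] := set_0Vmem K.
  by rewrite big_set0 mulr1; apply: power_ideal_sub.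
have iJ := subsetP sKJ i iK.
rewrite (big_setD1 i) //= [F i ^+ _ * _]mulrC mulrA.
case/(power_ideal_split iJ) => r.
have -> : ex K i = (a i).+1 by rewrite /ex iK.
rewrite exprS mulrA -mulrBl => /power_ideal_regularX Hr.
apply: (IH (K :\ i)); first by rewrite (cardsD1 i) iK in KN.
  by apply: subset_trans sKJ; apply: subsetDl.
apply: (@power_ideal_join _ _ i _ r) => //.
have -> : ex (K :\ i) i = 1%N by rewrite /ex !inE eqxx.
rewrite expr1; apply: (@power_ideal_sub (J :\ i) _ (ex K)) => //.
  by move=> j; rewrite /ex !inE => /andP[-> _].
apply: Hr => //.
  by apply: leq_trans Jc; apply: subset_leq_card; apply: subsetDl.
by rewrite !inE eqxx.
Qed.

End PowerIdeals.

#[local] Hint Resolve power_idealP face_idealP : core.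

(** * Noetherianity of polynomial rings and associated primes *)

Lemma ex_monotone_subsequence (u : nat -> nat) : exists phi : nat -> nat,
  (forall i, phi i < phi i.+1)%N /\ (forall i, u (phi i) <= u (phi i.+1))%N.
Proof.
have minP N : exists n, (N <= n)%N /\ forall n', (N <= n')%N -> (u n <= u n')%N.
  suff H v n : (N <= n)%N -> (u n < v)%N ->
      exists n, (N <= n)%N /\ forall n', (N <= n')%N -> (u n <= u n')%N.
    exact: (H (u N).+1 N).
  elim: v n => // v IH n Nn; rewrite ltnS => un.
  have [[n' [Nn' lt_u]]|H] :=
    classic (exists n', (N <= n')%N /\ (u n' < u n)%N).
    by apply: (IH n') => //; apply: leq_trans un.
  exists n; split=> // n' Nn'; rewrite leqNgt; apply/negP => lt_u.
  by apply: H; exists n'.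
pose g N := proj1_sig (constructive_indefinite_description _ (minP N)).
have gP N : (N <= g N)%N /\ forall n', (N <= n')%N -> (u (g N) <= u n')%N.
  by rewrite /g; case: constructive_indefinite_description.
pose phi := fix phi i := if i is i'.+1 then g (phi i').+1 else g 0%N.
exists phi; split=> i /=; first by have [] := gP (phi i).+1.
case: i => [|i] /=; first by apply: (gP 0%N).2.
apply: (gP (phi i).+1).2; apply: leq_trans (gP _).1.
by apply: leqW; apply: (gP _).1.
Qed.

Lemma dickson n (u : nat -> 'X_{1..n}) :
  exists i j, (i < j)%N /\ (u i <= u j)%MM.
Proof.
suff H k : (k <= n)%N -> exists phi : nat -> nat,
    (forall i, phi i < phi i.+1)%N /\
    (forall i (l : 'I_n), (l < k)%N -> (u (phi i) l <= u (phi i.+1) l)%N).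
  have [phi [phi_lt phi_le]] := H n (leqnn n).
  exists (phi 0%N), (phi 1%N); split=> //.
  by apply/mnm_lepP => l; apply: phi_le.
elim: k => [|k IH] kn; first by exists id.
have [phi [phi_lt phi_le]] := IH (ltnW kn).
have [psi [psi_lt psi_le]] :=
  ex_monotone_subsequence (fun i => u (phi i) (Ordinal kn)).
have phi_mono : {homo phi : i j / (i < j)%N}.
  by apply: homo_ltn => // ???; apply: ltn_trans.
exists (phi \o psi); split=> [i|i l] /=; first exact: phi_mono.
rewrite ltnS leq_eqVlt => /predU1P[lk|lk].
  by rewrite (_ : l = Ordinal kn); [apply: psi_le | apply: val_inj].
have mono : {homo (fun i => u (phi i) l) : i j / (i <= j)%N}.
  by apply: homo_leq => [//|???|j]; [apply: leq_trans|apply: phi_le].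
exact/mono/ltnW.
Qed.

Lemma ideal_span_mem (R : comNzRingType) (L : seq R) x :
  x \in L -> ideal_span L x.
Proof. exact: (@ideal_gen_mem _ (fun x => x \in L)). Qed.

Lemma ideal_spanP (R : comNzRingType) (L : seq R) : is_ideal (ideal_span L).
Proof. exact: ideal_gen_ideal. Qed.

#[local] Hint Resolve ideal_spanP : core.

(** Were [I] not finitely generated, one could choose elements of [I] one after
    the other, each of least leading monomial among those outside the span of
    its predecessors. By Dickson's lemma some leading monomial divides a later
    one; subtracting a multiple lowers the later element, against its choice. *)
Lemma hilbert_basis (k : fieldType) n (I : {mpoly k[n]} -> Prop) :
  is_ideal I -> exists L, forall x, I x <-> ideal_span L x.
Proof.
move=> idI; apply: NNPP => notFG.
(* The premise is inside the existential so that the choice below is total. *)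
have minx L : exists x, (forall y, y \in L -> I y) ->
    [/\ I x, ~ ideal_span L x &
      forall y, I y -> (mlead y < mlead x)%O -> ideal_span L y].
  have [LI|] := classic (forall y, y \in L -> I y); last by exists 0.
  have [x [Ix Lx]] : exists x, I x /\ ~ ideal_span L x.
    apply: NNPP => H; apply: notFG; exists L => x; split=> [Ix|].
      by apply: NNPP => Lx; apply: H; exists x.
    by apply: ideal_gen_min => // y /LI.
  move: {2}(mlead x) (erefl (mlead x)) Ix Lx => mx.
  elim/(well_founded_ind (@ltom_wf n)): mx x => mx IH x mxE Ix Lx.
  have [[y [Iy Ly lt_y]]|H] :=
    classic (exists y, [/\ I y, ~ ideal_span L y & (mlead y < mlead x)%O]).
    by apply: (IH (mlead y)) => //; rewrite -mxE.
  exists x => _; split=> // y Iy lt_y; apply: NNPP => Ly.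
  by apply: H; exists y.
pose next L := proj1_sig (constructive_indefinite_description _ (minx L)).
have nextP L : (forall y, y \in L -> I y) ->
    [/\ I (next L), ~ ideal_span L (next L) &
      forall y, I y -> (mlead y < mlead (next L))%O -> ideal_span L y].
  by rewrite /next; case: constructive_indefinite_description.
pose Ls := fix Ls i := if i is i'.+1 then next (Ls i') :: Ls i' else [::].
have LsI i : forall y, y \in Ls i -> I y.
  elim: i => //= i IH y; rewrite inE => /predU1P[->|]; last exact: IH.
  by have [] := nextP _ IH.
have Lsmem i j : (i < j)%N -> next (Ls i) \in Ls j.
  elim: j => // j IH; rewrite ltnS leq_eqVlt /= inE => /predU1P[->|/IH->].
    by rewrite eqxx.
  by rewrite orbT.
have [i [j [ij le_m]]] := dickson (fun i => mlead (next (Ls i))).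
have [Igj notLgj minj] := nextP _ (LsI j).
have [Igi notLgi _] := nextP _ (LsI i).
have := Lsmem _ _ ij; move: le_m Igj notLgj minj Igi notLgi.
set gi := next (Ls i); set gj := next (Ls j) => le_m Igj notLgj minj Igi notLgi.
move=> giLj.
have gi0 : gi != 0 by apply: contra_notN notLgi => /eqP->; apply: is_ideal0.
have gj0 : gj != 0 by apply: contra_notN notLgj => /eqP->; apply: is_ideal0.
pose q := (mleadc gj / mleadc gi) *: 'X_[mlead gj - mlead gi] : {mpoly k[n]}.
have lgi : mleadc gi != 0 by rewrite mleadc_eq0.
have mq : mlead (q * gi) = mlead gj.
  have c0 : mleadc gj / mleadc gi != 0.
    by rewrite mulf_neq0 ?invr_eq0 ?mleadc_eq0.
  rewrite mleadM ?mleadZ ?mleadXm ?submK //.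
  by rewrite scaler_eq0 negb_or c0 -msupp_eq0 msuppX.
have Lq : ideal_span (Ls j) (q * gi).
  by apply: is_idealM => //; apply: ideal_span_mem.
have cq : (q * gi)@_(mlead gj) = mleadc gj.
  have := mcoeffMX gi (mlead gj - mlead gi) (mlead gi).
  rewrite commr_mpolyX (submK le_m) => qE.
  by rewrite -scalerAl mcoeffZ qE divfK.
have [d0|d0] := eqVneq (gj - q * gi) 0.
  by apply: notLgj; rewrite -[gj](subrK (q * gi)) d0 add0r.
apply: notLgj; rewrite -[gj](subrK (q * gi)); apply: is_idealD => //.
apply: minj; first by apply: is_idealB => //; apply: is_idealM.
rewrite lt_neqAle; apply/andP; split.
  apply: contraTneq (mlead_supp d0) => ->.
  by rewrite -mcoeff_eq0 mcoeffB cq subrr.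
by apply: le_trans (mleadB_le _ _) _; rewrite mq joinxx.
Qed.

(** Noetherianity in the form in which it contradicts a strictly increasing chain
    of ideals: pick [h i] in the next ideal but not in the current one. *)
Lemma chain_stops (k : fieldType) n (h : nat -> {mpoly k[n]}) :
  exists i, ideal_gen (fun x => exists2 j, (j < i)%N & x = h j) (h i).
Proof.
pose S i x := exists2 j, (j < i)%N & x = h j.
have [L LE] := hilbert_basis (ideal_gen_ideal (fun x => exists j, x = h j)).
have Smono i i' x : (i <= i')%N -> ideal_gen (S i) x -> ideal_gen (S i') x.
  move=> ii'; apply: ideal_gen_mono => _ [j ji ->]; apply: ideal_gen_mem.
  by exists j => //; apply: leq_trans ii'.
have fin x : ideal_gen (fun x => exists j, x = h j) x ->
    exists i, ideal_gen (S i) x.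
  pose I x := exists i, ideal_gen (S i) x.
  apply: (@ideal_gen_min _ _ I) => [|_ [j ->]]; first split.
  - by exists 0%N; apply: is_ideal0; apply: ideal_gen_ideal.
  - move=> y z [i Hi] [i' Hi']; exists (maxn i i').
    by apply: is_idealD;
      [apply: ideal_gen_ideal|apply: Smono Hi|apply: Smono Hi'];
      rewrite ?leq_maxl ?leq_maxr.
  - move=> r y [i Hi]; exists i.
    by apply: is_idealM => //; apply: ideal_gen_ideal.
  - by exists j.+1; apply: ideal_gen_mem; exists j.
have [N LN] : exists N, forall x, x \in L -> ideal_gen (S N) x.
  have : forall x, x \in L -> exists i, ideal_gen (S i) x.
    by move=> x /ideal_span_mem/LE/fin.
  elim: (L) => [|y L' IH] HL; first by exists 0%N.
  have [|N HN] := IH; first by move=> x xL; apply: HL; rewrite inE xL orbT.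
  have [|i Hi] := HL y; first by rewrite inE eqxx.
  exists (maxn i N) => x; rewrite inE => /predU1P[->|/HN].
    by apply: Smono Hi; rewrite leq_maxl.
  by apply: Smono; rewrite leq_maxr.
exists N; apply: (@ideal_gen_mono _ (fun x => x \in L)) => //.
by apply/LE; apply: ideal_gen_mem; exists N.
Qed.

(** The existence of associated primes: a maximal element among the proper ideals
    [I : q x] is prime. *)
Lemma ex_prime_colon (k : fieldType) n (I : {mpoly k[n]} -> Prop) q :
  is_ideal I -> ~ I q -> exists x, is_prime_ideal (fun r => I (r * (q * x))).
Proof.
move=> idI Iq; apply: NNPP => notP.
(* If [I : q x] is not prime, some [y] makes [I : q x y] strictly larger. *)
have step (x : {mpoly k[n]}) : exists yz : {mpoly k[n]} * {mpoly k[n]},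
    ~ I (q * x) -> [/\ ~ I (q * (x * yz.1)), I (yz.2 * (q * (x * yz.1)))
      & ~ I (yz.2 * (q * x))].
  have [Ix|Ix] := classic (I (q * x)); first by exists (0, 0).
  apply: NNPP => H; apply: notP; exists x; split.
  - exact: colon_ideal.
  - by rewrite mul1r.
  - move=> a b abI; have [|bI] := classic (I (b * (q * x))); first by right.
    left; apply: NNPP => aI; apply: H; exists (b, a) => _; split=> //=.
      by have <- : b * (q * x) = q * (x * b) by ring.
    by have <- : a * b * (q * x) = a * (q * (x * b)) by ring.
pose f x := proj1_sig (constructive_indefinite_description _ (step x)).
have fP x : ~ I (q * x) -> [/\ ~ I (q * (x * (f x).1)),
    I ((f x).2 * (q * (x * (f x).1))) & ~ I ((f x).2 * (q * x))].
  by rewrite /f; case: constructive_indefinite_description.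
pose xs := fix xs i := if i is i'.+1 then xs i' * (f (xs i')).1 else 1.
have xsI i : ~ I (q * xs i).
  by elim: i => [|i /fP[]]; rewrite /= ?mulr1.
have [i Hi] := chain_stops (fun i => (f (xs i)).2).
have [_ _] := fP _ (xsI i); apply.
pose J r := I (r * (q * xs i)).
have : J (f (xs i)).2; last by [].
apply: ideal_gen_min Hi => [|_ [j ji ->]]; rewrite /J.
  exact: colon_ideal.
have [d ->] : exists d, xs i = xs j.+1 * d.
  elim: i {J} ji => // i IH; rewrite ltnS leq_eqVlt.
  case/predU1P=> [->|/IH[d /= ->]].
    by exists 1; rewrite mulr1.
  by eexists; rewrite -mulrA.
have [_ H _] := fP _ (xsI j).
by rewrite [q * _]mulrA [_ * (_ * d)]mulrA; apply: is_idealMr.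
Qed.

(** * Tie-breaking weights *)

Section Weights.
Variable s : nat.
Implicit Types (J : {set 'I_s}) (a w : 'I_s -> nat).
Local Open Scope nat_scope.

Lemma ltn_sum_in J (v w : 'I_s -> nat) j : j \in J ->
  {in J, forall i, v i <= w i} -> v j < w j ->
  \sum_(i in J) v i < \sum_(i in J) w i.
Proof.
move=> jJ le_vw lt_j; rewrite (bigD1 j) //= [X in _ < X](bigD1 j) //= -addSn.
by apply: leq_add => //; apply: leq_sum => i /andP[/le_vw].
Qed.

(** The exchange argument: a set on which a function is smaller than off it is the
    unique minimizer of the sum among the sets of its size. *)
Lemma ltn_sum_exchange (f : 'I_s -> nat) J J' :
  {in J & ~: J, forall j l, f j < f l} -> #|J'| = #|J| -> J' != J ->
  \sum_(j in J) f j < \sum_(j in J') f j.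
Proof.
move=> f_lt cardJ neqJ.
have card_diff : #|J' :\: J| = #|J :\: J'|.
  by have := cardsID J' J; have := cardsID J J'; rewrite setIC; lia.
have diff_gt0 : 0 < #|J :\: J'|.
  rewrite card_gt0; apply: contraNneq neqJ => d0.
  by rewrite eq_sym eqEcard -setD_eq0 d0 eqxx cardJ /=.
have split_sum (A B : {set 'I_s}) :
    \sum_(j in A) f j = \sum_(j in A :&: B) f j + \sum_(j in A :\: B) f j.
  exact: big_setID.
rewrite (split_sum J J') (split_sum J' J) setIC ltn_add2l.
pose M := \max_(j in J) f j.
apply: (@leq_ltn_trans (#|J :\: J'| * M)).
  rewrite -sum_nat_const; apply: leq_sum => j; rewrite !inE => /andP[_ jJ].
  exact: leq_bigmax_cond.
rewrite -card_diff; apply: (@leq_trans (#|J' :\: J| * M.+1)).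
  by rewrite ltn_mul2l card_diff diff_gt0 ltnSn.
rewrite -sum_nat_const; apply: leq_sum => l; rewrite !inE => /andP[lJ _].
have [j jJ] : exists j, j \in J.
  by apply/set0Pn; apply: contraTneq diff_gt0 => ->; rewrite set0D cards0.
rewrite /M.
have fl_gt0 : 0 < f l by apply: leq_ltn_trans (f_lt j l _ _); rewrite ?inE.
rewrite -(prednK fl_gt0) ltnS; apply/bigmax_leqP => i iJ.
by rewrite -ltnS prednK //; apply: f_lt; rewrite ?inE.
Qed.

Variable c : nat.
Hypothesis c_lt_s : c < s.

(** An injective refinement of the exponents: the dominant term makes sums over a
    set compare like the sums of the [a j], and the index [j] breaks ties, so
    that the set of the [c] smallest weights is unique. *)
Definition weight a (j : 'I_s) := s * s * a j + j.

Let ltn_ss (j : 'I_s) : j < s * s.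
Proof. by apply: leq_trans (ltn_ord j) _; nia. Qed.

Lemma weight_inj a : injective (weight a).
Proof.
move=> j l E; apply: val_inj => /=.
have mod_w i : weight a i %% (s * s) = i.
  by rewrite /weight mulnC modnMDl modn_small.
by rewrite -(mod_w j) -(mod_w l) E.
Qed.

Lemma leq_weight a w j : (weight a j <= weight w j) = (a j <= w j).
Proof. by rewrite leq_add2r leq_pmul2l //; have := ltn_ss j; lia. Qed.

Lemma sum_weight a J :
  \sum_(j in J) weight a j =
  s * s * (\sum_(j in J) a j) + \sum_(j in J) (j : nat).
Proof. by rewrite big_split /= -big_distrr. Qed.

Lemma sum_index_lt J : \sum_(j in J) (j : nat) < s * s.
Proof.
apply: (@leq_ltn_trans (\sum_(j < s) s.-1)).
  rewrite big_mkcond; apply: leq_sum => j _.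
  by case: ifP => // _; have := ltn_ord j; lia.
by rewrite sum_nat_const card_ord; nia.
Qed.

Definition heavy theta a :=
  forall J, #|J| = c -> theta <= \sum_(j in J) weight a j.

Definition c_heavy m a := forall J, #|J| = c -> m <= \sum_(j in J) a j.

Lemma heavy_c_heavy m a : heavy (s * s * m) a -> c_heavy m a.
Proof.
move=> a_heavy J Jc; have := a_heavy J Jc; rewrite sum_weight.
have lt_i := sum_index_lt J => le_m; rewrite leqNgt; apply/negP => lt_m.
have : s * s * (\sum_(j in J) a j).+1 <= s * s * m.
  by rewrite leq_mul2l lt_m orbT.
by rewrite mulnS; lia.
Qed.

(** Exchanging [j] in [J] for [l] outside cannot lower the sum of the weights, and
    weights are distinct. *)
Lemma heavy_separated theta a J : heavy theta a -> #|J| = c ->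
  \sum_(j in J) weight a j = theta ->
  {in J & ~: J, forall j l, weight a j < weight a l}.
Proof.
move=> a_heavy Jc sumJ j l jJ; rewrite inE => lJ.
have lj : l != j by apply: contraNneq lJ => ->.
have lJj : l \notin J :\ j by rewrite !inE (negbTE lJ) andbF.
rewrite ltn_neqAle (inj_eq (@weight_inj a)) eq_sym lj /=.
have : theta <= \sum_(i in l |: (J :\ j)) weight a i.
  by apply: a_heavy; rewrite cardsU1 lJj -Jc (cardsD1 j J) jJ.
by rewrite big_setU1 //= -sumJ (big_setD1 j) //= leq_add2r.
Qed.

(** The least exponent that agrees with [a] on [J] and has all its weights off [J]
    larger than those on [J]: the summand [l < j] is the amount by which the
    tie-break has to be overcome. *)
Definition lower J a (l : 'I_s) :=
  if l \in J then a l else \max_(j in J) (a j + (l < j)).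

Lemma eq_lower J a w : {in J, a =1 w} -> lower J a =1 lower J w.
Proof.
move=> aw l; rewrite /lower; case: ifP => [/aw//|_].
by apply: eq_bigr => j /aw->.
Qed.

Lemma lowerE J a j : j \in J -> lower J a j = a j.
Proof. by rewrite /lower => ->. Qed.

Lemma lower_separated J a :
  {in J & ~: J, forall j l, weight (lower J a) j < weight (lower J a) l}.
Proof.
move=> j l jJ; rewrite inE => lJ; rewrite /weight (lowerE a jJ).
rewrite /lower (negbTE lJ).
have lj : (l : nat) <> j by move=> /val_inj E; rewrite E jJ in lJ.
have : a j + (l < j) <= \max_(i in J) (a i + (l < i)).
  exact: (leq_bigmax_cond (F := fun i : 'I_s => a i + (l < i)) j).
set M := \max_(i in J) _ => le_M.
have : s * s * (a j + (l < j)) <= s * s * M by rewrite leq_mul2l le_M orbT.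
have := ltn_ss j; rewrite mulnDr; case: (ltngtP l j) lj => //=; lia.
Qed.

Lemma lower_le J a : {in J & ~: J, forall j l, weight a j < weight a l} ->
  forall l, lower J a l <= a l.
Proof.
move=> a_sep l; rewrite /lower; case: ifP => // /negbT lJ.
apply/bigmax_leqP => j jJ; have := a_sep j l jJ; rewrite inE => /(_ lJ).
rewrite /weight => lt_w; rewrite leqNgt; apply/negP => lt_a.
have : s * s * (a l).+1 <= s * s * (a j + (l < j)).
  by rewrite leq_mul2l lt_a orbT.
have := ltn_ss l; rewrite mulnDr mulnS; case: (ltnP l j) lt_w => /=; lia.
Qed.

End Weights.

(** * Monomial ideals *)

Section MonomialIdeals.
Variables (R : comNzRingType) (s : nat) (F : 'I_s -> R).
Implicit Types (J : {set 'I_s}) (a w : 'I_s -> nat) (U : ('I_s -> nat) -> Prop).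

Definition monomial_ideal U : R -> Prop :=
  ideal_gen (fun x => exists2 a, U a & x = monomial F a).

Lemma monomial_idealP U : is_ideal (monomial_ideal U).
Proof. exact: ideal_gen_ideal. Qed.

Hint Resolve monomial_idealP : core.

Lemma monomial_ideal_gen U a : U a -> monomial_ideal U (monomial F a).
Proof. by move=> Ua; apply: ideal_gen_mem; exists a. Qed.

Lemma monomial_ideal_power_ideal U J w x :
  (forall a, U a -> exists2 j, j \in J & (w j < a j)%N) ->
  monomial_ideal U x -> power_ideal F J (fun j => (w j).+1) x.
Proof.
move=> Uw; apply: ideal_gen_min => // _ [a /Uw[j jJ lt_wa] ->].
exact: power_ideal_monomial lt_wa.
Qed.

Lemma face_ideal_mul_monomial U J w r :
  (forall j, j \in J -> U (fun l => (l == j) + w l)%N) ->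
  face_ideal F J r -> monomial_ideal U (r * monomial F w).
Proof.
move=> Uw; pose I r := monomial_ideal U (r * monomial F w).
apply: (@ideal_gen_min _ _ I) => [|_ [j jJ ->]]; rewrite /I.
  exact: colon_ideal.
rewrite expr1 -(monomial1 F j) -monomialD.
exact/monomial_ideal_gen/Uw.
Qed.

Lemma ideal_span_face J x :
  ideal_span [seq F j | j <- enum J] x <-> face_ideal F J x.
Proof.
split; apply: ideal_gen_mono => y.
  case/mapP=> j; rewrite mem_enum => jJ ->.
  by apply: ideal_gen_mem; exists j.
case=> j jJ ->; apply: ideal_gen_mem; rewrite expr1.
by apply: map_f; rewrite mem_enum.
Qed.

(** [F_J^m] is contained in every ideal generated by the [F_j^(w_j + 1)], [j] in
    [J], with [sum_J w < m]; the power enters below through these ideals. *)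
Lemma prod_face_ideal J m (f : 'I_m -> R) w :
  (forall i, face_ideal F J (f i)) -> (\sum_(j in J) w j < m)%N ->
  power_ideal F J (fun j => (w j).+1) (\prod_(i < m) f i).
Proof.
elim: m => // m IH in f w * => Ff lt_w.
rewrite big_ord_recl; set y := \prod_(i < m) _.
pose I r := power_ideal F J (fun j => (w j).+1) (r * y).
suff : I (f ord0) by [].
apply: (@ideal_gen_min _ _ I) (Ff ord0) => [|_ [j jJ ->]]; rewrite /I.
  exact: colon_ideal.
(* If [w j = 0] then [F j] itself is a generator; otherwise the exponent of
   [F j] is lowered by one for the remaining factors. *)
case E : (w j) => [|wj].
  by apply: is_idealMr => //; rewrite -E; apply: power_ideal_gen.
pose w' l := if l == j then wj else w l.
have : power_ideal F J (fun j => (w' j).+1) y.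
  apply: IH => [i|]; first exact: Ff.
  rewrite -ltnS; apply: leq_trans lt_w; rewrite ltnS.
  rewrite (bigD1 j) //= [X in (_ < X)%N](bigD1 j) //= E /w' eqxx addSn ltnS.
  by rewrite leq_add2l; apply: leq_sum => l /andP[_ /negbTE->].
rewrite mulrC; pose I' r := power_ideal F J (fun j => (w j).+1) (r * F j ^+ 1).
apply: (@ideal_gen_min _ _ I') => [|_ [l lJ ->]]; rewrite /I'.
  exact: colon_ideal.
rewrite /w'; case: eqP => [->|_].
  by rewrite -exprD addn1 -E; apply: power_ideal_gen.
by apply: is_idealMr => //; apply: power_ideal_gen.
Qed.

Lemma ideal_power_sub (I : R -> Prop) J m w x :
  (forall y, I y -> face_ideal F J y) -> (\sum_(j in J) w j < m)%N ->
  ideal_power I m x -> power_ideal F J (fun j => (w j).+1) x.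
Proof.
move=> IF lt_w; apply: ideal_gen_min => // _ [f If ->].
by apply: prod_face_ideal => // i; apply/IF/If.
Qed.

Lemma monomial_factor J m a : (m <= \sum_(j in J) a j)%N ->
  exists e : 'I_m -> 'I_s, (forall i, e i \in J) /\
    exists r, monomial F a = r * \prod_(i < m) F (e i).
Proof.
elim: m => [|m IH] in a * => le_m.
  exists (fun i : 'I_0 => False_rect _ (notF (ltn_ord i))).
  split; first by case.
  by exists (monomial F a); rewrite big_ord0 mulr1.
have [j jJ aj] : exists2 j, j \in J & (0 < a j)%N.
  apply/exists_inP; apply: contraTT le_m => /exists_inPn a0.
  by rewrite big1 // => j /a0; rewrite -eqn0Ngt => /eqP.
pose a' l := (a l - (l == j))%N.
have aE : (fun l => (l == j) + a' l)%N =1 a.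
  by move=> l; rewrite /a' subnKC //; case: eqP => [->|].
have [|e [eJ [r rE]]] := IH a'.
  have : (\sum_(l in J) a l = 1 + \sum_(l in J) a' l)%N.
    rewrite -(eq_bigr _ (fun l _ => aE l)) big_split /=; congr addn.
    rewrite (bigD1 j) //= eqxx big1 ?addn0 // => l /andP[_ /negbTE->] //.
  by move=> E; rewrite E add1n in le_m.
exists (fun i => if unlift ord0 i is Some i' then e i' else j); split.
  by move=> i; case: unliftP.
exists r; rewrite big_ord_recl unlift_none -(eq_monomial _ aE) monomialD rE.
rewrite monomial1 mulrCA; congr (_ * (_ * _)).
by apply: eq_bigr => i _; rewrite liftK.
Qed.

End MonomialIdeals.

#[local] Hint Resolve monomial_idealP : core.

(** * From multipliers to monomials *)

Section Descent.
Variables (R : comNzRingType) (s c : nat) (F : 'I_s -> R).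
Hypothesis c_lt_s : (c < s)%N.
Hypothesis regF : permutable_regular F c.
Implicit Types (J : {set 'I_s}) (a : 'I_s -> nat).

Definition exponent m (w : {ffun 'I_s -> 'I_m.+1}) j : nat := w j.

(** Give an exponent as its weight the least sum of its [weight] over a set of
    size [c]. These are representatives in weight [theta]: every exponent of that
    weight is above one of them, and on the set where the weight is attained
    they are exceeded by each other and by the exponents of larger weight. *)
Definition layer m theta (w : {ffun 'I_s -> 'I_m.+1}) :=
  [exists J : {set 'I_s}, [&& #|J| == c,
    (\sum_(j in J) weight (exponent w) j == theta)%N
    & [forall l, exponent w l == lower J (exponent w) l]]].

(** An exponent [a] of weight [theta], attained on [J], is above [lower J a]. The
    bound on [theta] keeps the entries of [lower J a] at most [m]. *)
Lemma layer_decomposition m theta f : (theta < s * s * m)%N ->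
  monomial_ideal F (heavy c theta) f ->
  exists r : {ffun 'I_s -> 'I_m.+1} -> R,
    monomial_ideal F (heavy c theta.+1)
      (f - \sum_(w | layer theta w) r w * monomial F (exponent w)).
Proof.
move=> lt_theta.
pose I f := exists r : {ffun 'I_s -> 'I_m.+1} -> R,
    monomial_ideal F (heavy c theta.+1)
      (f - \sum_(w | layer theta w) r w * monomial F (exponent w)).
apply: (@ideal_gen_min _ _ I) => [|_ [a a_heavy ->]]; first split.
- exists (fun => 0); rewrite big1 ?subr0 => [|w _]; last by rewrite mul0r.
  exact: is_ideal0.
- move=> x y [rx Hx] [ry Hy]; exists (fun w => rx w + ry w).
  rewrite (eq_bigr _ (fun w _ => mulrDl _ _ _)) big_split /= opprD addrACA.
  exact: is_idealD.
- move=> z x [rx Hx]; exists (fun w => z * rx w).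
  rewrite (eq_bigr _ (fun w _ => esym (mulrA _ _ _))) -mulr_sumr -mulrBr.
  exact: is_idealM.
have [a_heavy'|] := classic (heavy c theta.+1 a).
  exists (fun => 0); rewrite big1 ?subr0 => [|w _]; last by rewrite mul0r.
  exact: monomial_ideal_gen.
move=> not_heavy; have [J [Jc /negP]] : exists J : {set 'I_s},
    #|J| = c /\ ~ (theta.+1 <= \sum_(j in J) weight a j)%N.
  apply: NNPP => H; apply: not_heavy => J Jc; apply: NNPP => lt_J.
  by apply: H; exists J.
rewrite -leqNgt => le_J.
have sumJ : (\sum_(j in J) weight a j = theta)%N.
  by apply/eqP; rewrite eqn_leq le_J (a_heavy J Jc).
have a_sep := heavy_separated c_lt_s a_heavy Jc sumJ.
have le_a := lower_le c_lt_s a_sep.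
have a_lt j : j \in J -> (a j < m)%N.
  move=> jJ; apply: (@leq_ltn_trans (\sum_(i in J) a i)).
    by rewrite (bigD1 j) //= leq_addr.
  by move: lt_theta; rewrite -sumJ sum_weight; nia.
have low_lt l : (lower J a l < m.+1)%N.
  rewrite ltnS /lower; case: ifP => [/a_lt/ltnW//|_].
  apply/bigmax_leqP => j /a_lt; case: (l < j)%N; lia.
pose w := [ffun l => Ordinal (low_lt l)].
have wE l : exponent w l = lower J a l by rewrite /exponent ffunE.
have wlayer : layer theta w.
  apply/existsP; exists J; rewrite Jc eqxx /=; apply/andP; split.
    rewrite -sumJ; apply/eqP; apply: eq_bigr => j jJ.
    by rewrite /weight wE lowerE.
  apply/forallP => l; rewrite wE; apply/eqP/eq_lower => j jJ.
  by rewrite wE lowerE.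
exists (fun w' =>
  if w' == w then monomial F (fun j => a j - exponent w j)%N else 0).
rewrite (bigD1 w) //= eqxx big1; last first.
  by move=> w' /andP[_ /negbTE->]; rewrite mul0r.
rewrite addr0 -monomial_le ?subrr => [|j]; last by rewrite wE le_a.
exact: is_ideal0.
Qed.

(** If [w'] did not exceed [w] on [J], the sum of its weights over [J] would be at
    most [theta]; the minimizer being unique, [J] would be the set of [w'] too,
    and [w'] would agree with [w] there and hence everywhere. *)
Lemma layer_min m theta (w w' : {ffun 'I_s -> 'I_m.+1}) J :
  #|J| = c -> (\sum_(j in J) weight (exponent w) j = theta)%N ->
  (forall l, exponent w l = lower J (exponent w) l) ->
  layer theta w' -> w' != w ->
  exists2 j, j \in J & (exponent w j < exponent w' j)%N.
Proof.
move=> Jc sumJ wE /existsP[J' /and3P[/eqP J'c /eqP sumJ' /forallP w'E]] neq.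
apply/exists_inP; apply: contraT => /exists_inPn le_w'.
have {}le_w' j : j \in J -> (exponent w' j <= exponent w j)%N.
  by move/le_w'; rewrite -leqNgt.
have sep : {in J' & ~: J',
    forall j l, weight (exponent w') j < weight (exponent w') l}%N.
  move=> j l jJ lJ; have := lower_separated c_lt_s (exponent w') jJ lJ.
  by rewrite /weight -!(eqP (w'E _)).
have le_sum : (\sum_(j in J) weight (exponent w') j <= theta)%N.
  by rewrite -sumJ; apply: leq_sum => j jJ; rewrite (leq_weight c_lt_s) le_w'.
have JJ' : J = J'.
  apply/eqP; apply: contraTT le_sum => neqJ; rewrite -ltnNge -sumJ'.
  by apply: (ltn_sum_exchange sep _ neqJ); rewrite Jc.
have eqJ : {in J, forall j, exponent w' j = exponent w j}.
  move=> j jJ; apply/eqP; rewrite eqn_leq le_w' //= leqNgt; apply/negP => lt_j.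
  suff : (\sum_(i in J) weight (exponent w') i <
          \sum_(i in J) weight (exponent w) i)%N by rewrite sumJ JJ' sumJ' ltnn.
  apply: (ltn_sum_in jJ) => [i /le_w'|]; first by rewrite (leq_weight c_lt_s).
  by rewrite ltnNge (leq_weight c_lt_s) -ltnNge.
case/eqP: neq. apply/ffunP => l; apply: val_inj.
rewrite -![val _]/(exponent _ l) wE (eqP (w'E l)) -JJ'; exact: eq_lower.
Qed.

Lemma heavy_shift theta w J j : #|J| = c -> j \in J ->
  (\sum_(i in J) weight w i = theta)%N ->
  (forall l, w l = lower J w l) -> heavy c theta.+1 (fun l => (l == j) + w l)%N.
Proof.
move=> Jc jJ sumJ wE J' J'c.
have le_w (K : {set 'I_s}) : (\sum_(i in K) weight w i <=
    \sum_(i in K) weight (fun l => (l == j) + w l) i)%N.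
  by apply: leq_sum => i _; rewrite (leq_weight c_lt_s) // leq_addl.
have [->|neq] := eqVneq J' J.
  rewrite -sumJ; apply: (ltn_sum_in jJ) => [i _|].
    by rewrite (leq_weight c_lt_s) leq_addl.
  by rewrite ltnNge (leq_weight c_lt_s) eqxx add1n ltnn.
apply: leq_trans (le_w J'); rewrite -sumJ.
apply: ltn_sum_exchange neq; last by rewrite Jc.
move=> i l iJ lJ; have := lower_separated c_lt_s w iJ lJ.
by rewrite /weight -!wE.
Qed.

(** The hypothesis says that no prime associated to [F_J] contains all the [g] that
    multiply [f] into [F_J^m], phrased so that it applies directly to a
    coefficient [q]. Induction on the weight threshold [theta]: the coefficient
    of each representative [w] of weight [theta] is found in [F_J], and
    multiplying [F^w] by [F_j] with [j] in [J] raises the weight. *)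
Lemma monomial_ideal_of_multipliers m f :
  (forall J q, #|J| = c ->
     (forall g,
        (forall w, (\sum_(j in J) w j < m)%N ->
           power_ideal F J (fun j => (w j).+1) (g * f)) ->
        face_ideal F J (g * q)) ->
     face_ideal F J q) ->
  monomial_ideal F (c_heavy c m) f.
Proof.
move=> f_mult.
suff main theta : (theta <= s * s * m)%N -> monomial_ideal F (heavy c theta) f.
  apply: ideal_gen_mono (main _ (leqnn _)) => _ [a /heavy_c_heavy a_heavy ->].
  exact: monomial_ideal_gen (a_heavy c_lt_s).
elim: theta => [|theta IH] lt_theta.
  have -> : f = f * monomial F (fun => 0%N).
    by rewrite /monomial big1 ?mulr1 // => j _; rewrite expr0.
  by apply: is_idealM => //; apply: monomial_ideal_gen.
have [r Hr] := layer_decomposition lt_theta (IH (ltnW lt_theta)).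
rewrite -(subrK (\sum_(w | layer theta w) r w * monomial F (exponent w)) f).
apply: is_idealD => //; apply: is_ideal_sum => // w wl.
case/existsP: (wl) => J /and3P[/eqP Jc /eqP sumJ /forallP wE].
have {}wE l : exponent w l = lower J (exponent w) l by apply/eqP.
apply: (@face_ideal_mul_monomial _ _ _ _ J) => [j jJ|].
  exact: heavy_shift wE.
apply: f_mult => // g Hg.
apply: (@power_ideal_colon _ _ F c regF _ (exponent w)); first by rewrite Jc.
have -> : g * r w * monomial F (exponent w) = g * f -
    g * (f - \sum_(w | layer theta w) r w * monomial F (exponent w)) -
    g * \sum_(w' | layer theta w' && (w' != w)) r w' * monomial F (exponent w').
  by rewrite (bigD1 w wl) /=; ring.
apply: is_idealB => //; first apply: is_idealB => //.
- by apply: Hg; move: lt_theta; rewrite -sumJ sum_weight; nia.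
- apply: is_idealM => //; move: Hr; apply: monomial_ideal_power_ideal.
  move=> a a_heavy; apply/exists_inP; apply: contraT => /exists_inPn le_a.
  suff : (theta.+1 <= theta)%N by rewrite ltnn.
  rewrite -[X in (_ <= X)%N]sumJ; apply: leq_trans (a_heavy _ Jc) _.
  by apply: leq_sum => j /le_a; rewrite (leq_weight c_lt_s) // -leqNgt.
- apply: is_idealM => //; apply: is_ideal_sum => // w' /andP[w'l neq].
  have [j jJ lt_w] := layer_min Jc sumJ wE w'l neq.
  by apply: is_idealM => //; apply: power_ideal_monomial lt_w.
Qed.

End Descent.

(** * Symbolic powers of star ideals *)

Section Symbolic.
Variable R : idomainType.
Local Notation "x %:F" := (FracField.tofrac x).

(** Clearing a common denominator removes the fraction field from everything that
    follows. *)
Lemma extended_ideal_clear (P I : R -> Prop) f :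
  is_prime_ideal P -> is_ideal I ->
  extended_ideal P I f%:F <-> exists2 g, ~ P g & I (g * f).
Proof.
move=> [[P0 PD PM] P1 Pmul] idI; split; last first.
  case=> g Pg Igf; have g0 : g%:F != 0.
    by rewrite tofrac_eq0; apply: contra_notN Pg => /eqP->.
  exists [:: (1 / g%:F, g * f)] => [p|].
    by rewrite inE => /eqP->; split=> //; exists 1, g; rewrite rmorph1.
  by rewrite big_seq1 /= tofracM mulrA div1r mulVf // mul1r.
case=> e He fE.
suff [g Pg [y Iy gE]] : exists2 g, ~ P g &
    exists2 y, I y & g%:F * (\sum_(p <- e) p.1 * p.2%:F) = y%:F.
  exists g => //; move: gE; rewrite -fE -tofracM => /eqP.
  by rewrite tofrac_eq => /eqP->.
elim: e He {fE} => [|p e IH] He.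
  exists 1 => //; exists 0; first exact: is_ideal0.
  by rewrite big_nil mulr0 tofrac0.
have [|g Pg [y Iy gE]] := IH.
  by move=> q qe; apply: He; rewrite inE qe orbT.
have [[a [h [Ph pE]]] Ip] := He p (mem_head _ _).
have h0 : h%:F != 0.
  by rewrite tofrac_eq0; apply: contra_notN Ph => /eqP->.
exists (g * h); first by move=> /Pmul[].
exists (g * a * p.2 + h * y).
  by apply: is_idealD => //; apply: is_idealM.
rewrite big_cons mulrDr tofracD; congr (_ + _).
  have frac_eq (K : fieldType) (x z u v : K) :
      z != 0 -> x * z * (u / z * v) = x * u * v by move=> ?; field.
  by rewrite pE !tofracM frac_eq.
by rewrite !tofracM -gE; ring.
Qed.

Lemma symbolic_powerP (I : R -> Prop) m f :
  symbolic_power I m f <-> forall P, associated_prime I P ->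
    exists2 g, ~ P g & ideal_power I m (g * f).
Proof.
have idIm := ideal_gen_ideal (fun x => exists2 a : 'I_m -> R,
  (forall i, I (a i)) & x = \prod_(i < m) a i).
by split=> H P PI; apply/(extended_ideal_clear _ PI.1 idIm); apply: H.
Qed.

Lemma symbolic_power_ideal (I : R -> Prop) m : is_ideal (symbolic_power I m).
Proof.
have idIm := ideal_gen_ideal (fun x => exists2 a : 'I_m -> R,
  (forall i, I (a i)) & x = \prod_(i < m) a i).
split.
- apply/symbolic_powerP => P [[_ P1 _] _]; exists 1 => //.
  by rewrite mulr0; apply: is_ideal0 idIm.
- move=> x y /symbolic_powerP Hx /symbolic_powerP Hy.
  apply/symbolic_powerP => P PI.
  have [g Pg Ig] := Hx P PI; have [h Ph Ih] := Hy P PI.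
  exists (g * h); first by have [[_ _ Pmul] _] := PI => /Pmul[].
  have -> : g * h * (x + y) = h * (g * x) + g * (h * y) by ring.
  by apply: (is_idealD idIm); apply: (is_idealM _ idIm).
- move=> r x /symbolic_powerP Hx; apply/symbolic_powerP => P PI.
  have [g Pg Ig] := Hx P PI; exists g => //.
  by rewrite mulrCA; apply: (is_idealM _ idIm).
Qed.

Hypothesis ex_prime_colonR : forall (I : R -> Prop) q, is_ideal I -> ~ I q ->
  exists x, is_prime_ideal (fun r => I (r * (q * x))).
Variables (s c : nat) (F : 'I_s -> R).
Hypothesis c_lt_s : (c < s)%N.
Hypothesis regF : permutable_regular F c.
Implicit Types (J : {set 'I_s}) (a : 'I_s -> nat).

Lemma star_idealP f :
  star_ideal F c f <-> forall J, #|J| = c -> face_ideal F J f.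
Proof. by split=> H J Jc; apply/ideal_span_face; apply: H. Qed.

Definition coface J : R := \prod_(l | l \notin J) F l.

Lemma face_ideal_coface J J' : #|J| = c -> #|J'| = c -> J' != J ->
  face_ideal F J' (coface J).
Proof.
move=> Jc J'c neq.
have [l lJ' lJ] : exists2 l, l \in J' & l \notin J.
  apply/exists_inP; apply: contraNT neq => /exists_inPn J'J.
  rewrite eqEcard Jc J'c leqnn andbT; apply/subsetP => l /J'J.
  by rewrite negbK.
rewrite /coface (bigD1 l) //=; apply: is_idealMr => //.
exact: face_ideal_gen.
Qed.

(** The product of the forms outside [J] is regular modulo [F_J]; with
    [face_ideal_coface] this isolates the component [F_J] of the intersection
    [I_c]. *)
Lemma face_ideal_coface_cancel J z : #|J| = c ->
  face_ideal F J (z * coface J) -> face_ideal F J z.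
Proof.
move=> Jc H; apply: (@power_ideal_regular_prod _ _ F c regF _ _ (fun => 1%N)).
- by rewrite Jc.
- by [].
- by rewrite (eq_bigr _ (fun l _ => expr1 _)).
Qed.

(** If [q] is not in [F_J], a prime [P = F_J : q x] is also [I_c : q x M], where [M]
    is the product of the forms outside [J]; so [P] is associated to [I_c] and
    some [g] outside [P] multiplies [f] into [I_c^m]. *)
Lemma symbolic_star_sub m f :
  symbolic_power (star_ideal F c) m f -> monomial_ideal F (c_heavy c m) f.
Proof.
move=> /symbolic_powerP f_symb.
apply: (monomial_ideal_of_multipliers c_lt_s regF) => J q Jc Hq.
apply: NNPP => Fq.
have [x Px] := ex_prime_colonR (power_idealP F J (fun => 1%N)) Fq.
have [|g Pg Ig] := f_symb (fun r => face_ideal F J (r * (q * x))).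
  split=> //; exists (q * x * coface J) => r.
  rewrite [X in star_ideal _ _ X]mulrA.
  split=> [Hr|/star_idealP/(_ J Jc) Hr]; last first.
    exact: face_ideal_coface_cancel Hr.
  apply/star_idealP => J' J'c; have [->|neq] := eqVneq J' J.
    exact: is_idealMr.
  by apply: is_idealM => //; apply: face_ideal_coface.
apply: Pg; rewrite mulrA; apply: is_idealMr => //; apply: Hq => w lt_w.
by apply: ideal_power_sub lt_w Ig => y /star_idealP; apply.
Qed.

(** A prime [P = I_c : x] is the intersection of the [F_J : x], hence contains one
    of them; then [F_l] in [P] would give [F_l x] in [F_J], so [x] in [F_J] and 1
    in [P]. *)
Lemma associated_prime_star P : associated_prime (star_ideal F c) P ->
  exists2 J : {set 'I_s}, #|J| = c & forall l, l \notin J -> ~ P (F l).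
Proof.
case=> [[idP P1 Pmul] [x Px]].
have [J Jc JP] : exists2 J : {set 'I_s}, #|J| = c &
    forall r, face_ideal F J (r * x) -> P r.
  apply: NNPP => noJ.
  suff [r Pr rJ] : exists2 r, ~ P r &
      forall J : {set 'I_s}, J \in enum {set 'I_s} ->
      #|J| = c -> face_ideal F J (r * x).
    apply: Pr; apply/Px/star_idealP => J Jc; apply: rJ => //.
    by rewrite mem_enum.
  elim: (enum _) => [|J L [r Pr rL]]; first by exists 1.
  have [Jc|Jc] := classic (#|J| = c); last first.
    by exists r => // J'; rewrite inE => /predU1P[->//|]; apply: rL.
  have [h [Ph hJ]] : exists h, ~ P h /\ face_ideal F J (h * x).
    apply: NNPP => H; apply: noJ; exists J => // h hJ.
    by apply: NNPP => Ph; apply: H; exists h.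
  exists (h * r) => [/Pmul[]//|J'].
  rewrite inE => /predU1P[-> _|/rL/[apply] rJ'].
    by rewrite mulrAC; apply: is_idealMr.
  by rewrite -mulrA; apply: is_idealM.
exists J => // l lJ /Px/star_idealP/(_ J Jc).
rewrite mulrC => /(regF _ lJ); rewrite Jc => /(_ (leqnn _)) xJ.
by apply: P1; apply: JP; rewrite mul1r.
Qed.

(** The product [M] of the forms outside [J] is a unit in the localization, and
    [F_j M] lies in [I_c] for [j] in [J]. *)
Lemma symbolic_star_monomial m a : c_heavy c m a ->
  symbolic_power (star_ideal F c) m (monomial F a).
Proof.
move=> a_heavy; apply/symbolic_powerP => P PI.
have [J Jc JP] := associated_prime_star PI.
have [[idP P1 Pmul] _] := PI.
have [e [eJ [r ->]]] := monomial_factor F (a_heavy J Jc).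
exists (coface J ^+ m).
  have PJ : ~ P (coface J).
    by rewrite /coface; apply: (big_ind (fun y => ~ P y)) => // y z ? ? /Pmul[].
  by elim: m {a_heavy e eJ} => // m IH; rewrite exprS => /Pmul[].
have -> : coface J ^+ m * (r * \prod_(i < m) F (e i)) =
    r * \prod_(i < m) (F (e i) * coface J).
  by rewrite big_split /= prodr_const card_ord; ring.
apply: is_idealM; first exact: ideal_gen_ideal.
apply: ideal_gen_mem; exists (fun i => F (e i) * coface J) => // i.
apply/star_idealP => J' J'c; have [->|neq] := eqVneq J' J.
  by apply: is_idealMr => //; apply: face_ideal_gen.
by apply: is_idealM => //; apply: face_ideal_coface.
Qed.

Lemma symbolic_starE m f :
  symbolic_power (star_ideal F c) m f <-> monomial_ideal F (c_heavy c m) f.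
Proof.
split; first exact: symbolic_star_sub.
apply: ideal_gen_min => [|_ [a a_heavy ->]]; first exact: symbolic_power_ideal.
exact: symbolic_star_monomial.
Qed.

End Symbolic.

(** * Minimal exponents *)

Section MinimalExponents.
Variables (s c m : nat).
Hypothesis c_lt_s : (c < s)%N.
Implicit Types (J : {set 'I_s}) (a b : 'I_s -> nat).
Local Open Scope nat_scope.

(** The last equation amounts to a sum [m] over the [c] smallest entries. *)
Definition minimal_exponent t a :=
  [&& [forall j, a j <= t], s - c < #|[set j | a j == t]|
    & \sum_j a j == t * (s - c) + m].

Lemma card_setC_face J : #|J| = c -> #|~: J| = s - c.
Proof. by move=> Jc; have := cardsC J; rewrite card_ord Jc; lia. Qed.

Lemma sum_split J a :
  \sum_j a j = \sum_(j in J) a j + \sum_(j in ~: J) a j.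
Proof.
rewrite (bigID (mem J)) /=; congr (_ + _); apply: eq_bigl => j.
by rewrite inE.
Qed.

Lemma minimal_exponent_c_heavy t a : minimal_exponent t a -> c_heavy c m a.
Proof.
case/and3P=> /forallP a_le _ /eqP sum_a J Jc.
move: sum_a; rewrite (sum_split J).
have : \sum_(j in ~: J) a j <= \sum_(j in ~: J) t by apply: leq_sum => j _.
by rewrite sum_nat_const card_setC_face //; lia.
Qed.

Lemma minimal_exponent_face t a : minimal_exponent t a ->
  exists J, [/\ #|J| = c, (forall l, l \notin J -> a l = t) & 
    \sum_(j in J) a j = m].
Proof.
case/and3P=> /forallP a_le card_t /eqP sum_a.
have /card_geqP[l [l_uniq l_size l_t]] := ltnW card_t.
pose J := ~: [set j in l].
have Jc : #|J| = c.
  have := cardsC [set j in l].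
  rewrite card_ord cardsE (card_uniqP l_uniq) l_size.
  by rewrite -/J; lia.
have aJ j : j \notin J -> a j = t.
  by rewrite !inE negbK => /l_t; rewrite inE => /eqP.
exists J; split=> //; move: sum_a; rewrite (sum_split J).
rewrite [X in _ + X](eq_bigr (fun => t)) => [|j]; last first.
  by rewrite in_setC; apply: aJ.
by rewrite sum_nat_const card_setC_face //; lia.
Qed.

(** A set of size [c] over which [a] sums to [m] contains all entries below [t],
    since the [s - c] remaining ones must sum to [t * (s - c)]; and it contains
    an entry equal to [t], since there are more than [s - c] of them. *)
Lemma minimal_exponent_off t a J : minimal_exponent t a -> #|J| = c ->
  \sum_(j in J) a j = m ->
  (forall l, l \notin J -> a l = t) /\ exists2 j, j \in J & a j = t.
Proof.
case/and3P=> /forallP a_le card_t /eqP sum_a Jc sumJ; split=> [l lJ|].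
  apply/eqP; rewrite eqn_leq a_le leqNgt; apply/negP => lt_l.
  have lJ' : l \in ~: J by rewrite inE.
  move: sum_a; rewrite (sum_split J) sumJ => /eqP.
  apply/negP; rewrite neq_ltn; apply/orP; left.
  rewrite addnC ltn_add2r -(card_setC_face Jc) mulnC -sum_nat_const.
  exact: ltn_sum_in lJ' _ lt_l.
suff /exists_inP[j jJ /eqP ajt] : [exists j in J, a j == t] by exists j.
apply: contraTT card_t => /exists_inPn a_neq.
rewrite -leqNgt -(card_setC_face Jc); apply: subset_leq_card.
apply/subsetP => j; rewrite !inE => /eqP ajt; apply/negP => /a_neq.
by rewrite ajt eqxx.
Qed.

Lemma minimal_exponent_range t a : minimal_exponent t a -> m <= c * t /\ t <= m.
Proof.
move=> a_min; have [J [Jc _ sumJ]] := minimal_exponent_face a_min.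
have [_ [j jJ ajt]] := minimal_exponent_off a_min Jc sumJ.
split; last by rewrite -ajt -sumJ (bigD1 j) //= leq_addr.
rewrite -sumJ -Jc -sum_nat_const; apply: leq_sum => i _.
by case/and3P: a_min => /forallP.
Qed.

(** Otherwise [b <= a] on [J]; as [b] sums to at least [m] there, it agrees with
    [a] on [J], and off [J] both are constant, equal to their maximum on [J]. *)
Lemma minimal_exponent_exceeds t t' a b J :
  minimal_exponent t a -> minimal_exponent t' b -> #|J| = c ->
  \sum_(j in J) a j = m -> (exists l, b l <> a l) ->
  exists2 j, j \in J & a j < b j.
Proof.
move=> a_min b_min Jc sumJ [l ba].
apply/exists_inP; apply: contra_notT ba => /exists_inPn le_ba.
have {}le_ba j : j \in J -> b j <= a j by move/le_ba; rewrite -leqNgt.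
have sumb : \sum_(j in J) b j = m.
  apply/eqP; rewrite eqn_leq (minimal_exponent_c_heavy b_min) // andbT -sumJ.
  exact: leq_sum.
have eq_ba j : j \in J -> b j = a j.
  move=> jJ; apply/eqP; rewrite eqn_leq le_ba //= leqNgt; apply/negP => lt_j.
  suff : \sum_(i in J) b i < \sum_(i in J) a i by rewrite sumb sumJ ltnn.
  exact: ltn_sum_in jJ le_ba lt_j.
have [a_off [i iJ ai]] := minimal_exponent_off a_min Jc sumJ.
have [b_off [i' i'J bi']] := minimal_exponent_off b_min Jc sumb.
have [/eq_ba//|lJ] := boolP (l \in J).
case/and3P: a_min => /forallP a_le _ _; case/and3P: b_min => /forallP b_le _ _.
have le_tt' : t <= t' by rewrite -ai -eq_ba.
have le_t't : t' <= t by rewrite -bi' eq_ba.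
by rewrite a_off // b_off //; lia.
Qed.

Hypothesis c_ge1 : 1 <= c.

(** Lower entries as long as the condition on [c]-subsets survives. When none can
    be lowered, let [J] minimize the sum: the sum over [J] is [m], since otherwise
    any positive entry could be lowered, and the entries off [J] equal the
    maximum on [J], since a larger one could be lowered. *)
Lemma ex_minimal_exponent a : c_heavy c m a ->
  exists t b, minimal_exponent t b /\ forall j, b j <= a j.
Proof.
have [N] := ubnP (\sum_j a j); elim: N => // N IH in a *.
rewrite ltnS => leN a_heavy.
pose dec j l := a l - (l == j).
have [[j [aj dec_heavy]]|no_dec] :=
  classic (exists j, 0 < a j /\ c_heavy c m (dec j)).
  have [|t [b [b_min le_b]]] := IH (dec j) _ dec_heavy.
    apply: leq_trans leN; rewrite (bigD1 j) //= [X in _ < X](bigD1 j) //=.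
    rewrite /dec eqxx -addSn subn1 prednK //; apply: leq_add => //.
    by apply: leq_sum => i _; apply: leq_subr.
  exists t, b; split=> // l; apply: leq_trans (le_b l) _; exact: leq_subr.
have [J0 J0c] : exists J : {set 'I_s}, #|J| = c.
  have /card_geqP[l [l_uniq l_size _]] : c <= #|'I_s| by rewrite card_ord ltnW.
  by exists [set j in l]; rewrite cardsE (card_uniqP l_uniq).
have [J /eqP Jc J_min] :
    exists2 J : {set 'I_s}, #|J| == c & forall J' : {set 'I_s}, #|J'| == c ->
      \sum_(j in J) a j <= \sum_(j in J') a j.
  have J0P : #|J0| == c by apply/eqP.
  have [J Jc HJ] := @arg_minnP _ J0 (fun J : {set 'I_s} => #|J| == c)
    (fun J : {set 'I_s} => \sum_(j in J) a j) J0P.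
  by exists J.
(* Moving from [A] to [A - l + j]; stated without subtraction. *)
have sum_swap (A : {set 'I_s}) j l : j \notin A -> l \in A ->
    \sum_(i in j |: (A :\ l)) a i + a l = \sum_(i in A) a i + a j.
  move=> jA lA; rewrite big_setU1 /= ?(big_setD1 l lA) /=; first by lia.
  by rewrite !inE (negbTE jA) andbF.
have card_swap (A : {set 'I_s}) j l : j \notin A -> l \in A ->
    #|j |: (A :\ l)| = #|A|.
  move=> jA lA; rewrite cardsU1 !inE (negbTE jA) andbF (cardsD1 l A) lA.
  by rewrite add1n.
have le_off j l : j \in J -> l \notin J -> a j <= a l.
  move=> jJ lJ; have := J_min (l |: (J :\ j)); rewrite card_swap // Jc eqxx.
  by move=> /(_ isT); have := sum_swap J l j lJ jJ; lia.
have [j0 j0J j0max] : exists2 j0, j0 \in J & forall j, j \in J -> a j <= a j0.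
  have [j jJ] : exists j, j \in J by apply/set0Pn; rewrite -card_gt0 Jc.
  by have [i iJ Hi] := @arg_maxnP _ j (mem J) a jJ; exists i.
have off_eq l : l \notin J -> a l = a j0.
  move=> lJ; apply/eqP; rewrite eqn_leq (le_off j0 l) // andbT leqNgt.
  apply/negP => lt_l; apply: no_dec; exists l; split; first by lia.
  move=> J' J'c; have [lJ'|lJ'] := boolP (l \in J'); last first.
    rewrite (eq_bigr a); first exact: a_heavy.
    move=> i iJ'; rewrite /dec.
    by case: eqP => [E|_]; [rewrite -E iJ' in lJ'|lia].
  have [j jJ jJ'] : exists2 j, j \in J & j \notin J'.
    apply/exists_inP; apply: contraNT lJ => /exists_inPn JJ'.
    suff -> : J = J' by [].
    apply/eqP; rewrite eqEcard Jc J'c leqnn andbT; apply/subsetP => i /JJ'.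
    by rewrite negbK.
  have := a_heavy (j |: (J' :\ l)); rewrite card_swap // => /(_ J'c).
  have := sum_swap J' j l jJ' lJ'; have := j0max j jJ.
  rewrite !(big_setD1 l lJ') /= /dec eqxx.
  rewrite [in X in _ -> _ -> _ -> _ <= _ + X](eq_bigr a); first by lia.
  by move=> i; rewrite !inE => /andP[/negbTE-> _]; rewrite subn0.
have sumJ : \sum_(j in J) a j = m.
  apply/eqP; rewrite eqn_leq a_heavy // andbT leqNgt; apply/negP => lt_m.
  have [j aj] : exists j, 0 < a j.
    apply: NNPP => H; move: lt_m; rewrite big1 // => j _.
    by apply/eqP; rewrite eqn0Ngt; apply/negP => aj; apply: H; exists j.
  apply: no_dec; exists j; split=> // J' /eqP J'c.
  have : m < \sum_(i in J') a i by apply: leq_trans lt_m (J_min _ J'c).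
  have [jJ'|jJ'] := boolP (j \in J'); last first.
    rewrite (eq_bigr (dec j)) => [|i iJ']; first exact: ltnW.
    by rewrite /dec; case: eqP => [E|_]; [rewrite -E iJ' in jJ'|lia].
  rewrite !(big_setD1 j jJ') /= /dec eqxx.
  rewrite [in X in _ -> _ <= _ + X](eq_bigr a); first by lia.
  by move=> i; rewrite !inE => /andP[/negbTE-> _]; rewrite subn0.
exists (a j0), a; split=> //; apply/and3P; split.
- apply/forallP => l; have [/j0max//|/off_eq->//] := boolP (l \in J).
- have j0C : j0 \notin ~: J by rewrite inE negbK.
  have : #|j0 |: ~: J| <= #|[set j | a j == a j0]|.
    apply: subset_leq_card; apply/subsetP => l; rewrite !inE.
    by case/predU1P => [->|/off_eq->].
  by rewrite cardsU1 j0C (card_setC_face Jc) add1n.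
- rewrite (sum_split J) sumJ.
  rewrite [X in _ + X](eq_bigr (fun => a j0)) => [|l]; last first.
    by rewrite in_setC; apply: off_eq.
  by rewrite sum_nat_const (card_setC_face Jc) mulnC addnC.
Qed.

End MinimalExponents.

Section StarGenerators.
Variables (R : comNzRingType) (s c m : nat) (F : 'I_s -> R).
Hypotheses (c_ge1 : (1 <= c)%N) (c_lt_s : (c < s)%N).

Definition star_exponents : {set {ffun 'I_s -> 'I_m.+1}} :=
  [set w | [exists t : 'I_m.+1, minimal_exponent c m t (exponent w)]].

Definition star_generators : seq R :=
  [seq monomial F (exponent w) | w <- enum star_exponents].

Lemma star_exponentsP w :
  reflect (exists t, minimal_exponent c m t (exponent w)) (w \in star_exponents).
Proof.
rewrite inE; apply: (iffP existsP) => [[t w_min]|[t w_min]]; first by exists t.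
have [_] := minimal_exponent_range c_lt_s w_min.
by rewrite -ltnS => lt_t; exists (Ordinal lt_t).
Qed.

Lemma star_generators_span f :
  monomial_ideal F (c_heavy c m) f <-> ideal_span star_generators f.
Proof.
split; apply: ideal_gen_min => //; last first.
  move=> x /mapP[w]; rewrite mem_enum => /star_exponentsP[t w_min] ->.
  exact/monomial_ideal_gen/(minimal_exponent_c_heavy c_lt_s w_min).
move=> _ [a a_heavy ->].
have [t [b [b_min le_b]]] := ex_minimal_exponent c_lt_s c_ge1 a_heavy.
have b_lt j : (b j < m.+1)%N.
  have [_ tm] := minimal_exponent_range c_lt_s b_min.
  by case/and3P: b_min => /forallP b_le _ _; apply: leq_trans (b_le j) tm.
pose w := [ffun j => Ordinal (b_lt j)] : {ffun 'I_s -> 'I_m.+1}.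
have wb : exponent w =1 b by move=> j; rewrite /exponent ffunE.
rewrite (monomial_le F le_b); apply: is_idealM => //.
apply: ideal_span_mem; rewrite -(eq_monomial F wb).
apply: map_f; rewrite mem_enum; apply/star_exponentsP; exists t.
case/and3P: b_min => /forallP b_le b_card b_sum; apply/and3P; split.
- by apply/forallP => j; rewrite wb.
- by rewrite (eq_card (_ : _ =i [set j | b j == t])) // => j; rewrite !inE wb.
- by rewrite (eq_bigr b).
Qed.

Hypothesis regF : permutable_regular F c.

(** Every other term of the relation exceeds [w] somewhere on [J], so the colon
    computation applies to the term of [w]. *)
Lemma star_relation (r : {ffun 'I_s -> 'I_m.+1} -> R) w :
  \sum_(v in star_exponents) r v * monomial F (exponent v) = 0 ->
  w \in star_exponents ->
  exists2 J : {set 'I_s}, #|J| = c & face_ideal F J (r w).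
Proof.
move=> rel wM; have [t w_min] := star_exponentsP _ wM.
have [J [Jc _ sumJ]] := minimal_exponent_face c_lt_s w_min.
exists J => //; apply: (@power_ideal_colon _ _ F c regF _ (exponent w)).
  by rewrite Jc.
move: rel; rewrite (bigD1 w) //= => /eqP; rewrite addr_eq0 => /eqP->.
apply: is_idealN => //; apply: is_ideal_sum => // v /andP[vM neq].
have [t' v_min] := star_exponentsP _ vM.
apply: is_idealM => //.
have [|j jJ lt_j] := minimal_exponent_exceeds c_lt_s w_min v_min Jc sumJ.
  apply: NNPP => H; case/eqP: neq; apply/ffunP => l; apply: val_inj.
  by apply: NNPP => E; apply: H; exists l.
exact: power_ideal_monomial lt_j.
Qed.

End StarGenerators.

(** Apply the hypothesis to the sequence that lists [T], then [i], then enough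
    other indices. *)
Lemma regular_sequence_permutable (R : comNzRingType) s c (F : 'I_s -> R) :
  (c < s)%N ->
  (forall r : seq 'I_s, uniq r -> size r = c.+1 ->
     regular_sequence [seq F j | j <- r]) ->
  permutable_regular F c.
Proof.
move=> c_lt_s F_reg T i z Tc iT.
pose rest := take (c - #|T|) (enum (~: (i |: T))).
have rest_size : size rest = (c - #|T|)%N.
  rewrite size_takel // -cardE.
  by have := cardsC (i |: T); rewrite card_ord cardsU1 iT; lia.
have r_uniq : uniq (enum T ++ i :: rest).
  rewrite cat_uniq enum_uniq /= take_uniq ?enum_uniq // andbT negb_or.
  rewrite mem_enum iT /=; apply/andP; split.
    apply/hasPn => j /mem_take; rewrite !mem_enum !inE negb_or.
    by case/andP.
  by apply/negP => /mem_take; rewrite mem_enum !inE eqxx.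
have [|reg _] := F_reg _ r_uniq.
  by rewrite size_cat /= rest_size -cardE addnS subnKC.
have := reg #|T|; rewrite map_cat size_cat /= take_size_cat; last first.
  by rewrite size_map -cardE.
rewrite nth_cat !size_map -!cardE ltnn subnn /= -addSnnS ltn_addr //.
by move=> /(_ isT z) Hz /ideal_span_face/Hz/ideal_span_face.
Qed.

(** * Minimal homogeneous generators *)

Section Nakayama.
Variables (k : fieldType) (n : nat).
Local Notation R := {mpoly k[n]}.
Implicit Types (G H : seq R) (r : nat -> R).

Lemma sum_delta G i : (i < size G)%N ->
  \sum_(j < size G) ((j : nat) == i)%:R * G`_j = G`_i.
Proof.
move=> iG; rewrite (bigD1 (Ordinal iG)) //= eqxx mul1r big1 ?addr0 // => j.
by rewrite -val_eqE /= => /negbTE->; rewrite mul0r.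
Qed.

Lemma ideal_spanE G x :
  ideal_span G x <-> exists r, x = \sum_(i < size G) r i * G`_i.
Proof.
split=> [|[r ->]]; last first.
  apply: is_ideal_sum => // i _; apply: is_idealM => //.
  by apply: ideal_span_mem; apply: mem_nth.
pose I x := exists r, x = \sum_(i < size G) r i * G`_i.
apply: (@ideal_gen_min _ _ I) => [|y yG]; first split.
- by exists (fun => 0); rewrite big1 // => i _; rewrite mul0r.
- move=> y z [r ->] [q ->]; exists (fun i => r i + q i).
  by rewrite -big_split; apply: eq_bigr => i _; rewrite mulrDl.
- move=> y z [r ->]; exists (fun i => y * r i).
  by rewrite mulr_sumr; apply: eq_bigr => i _; rewrite mulrA.
exists (fun i => (i == index y G)%:R).
have iG : (index y G < size G)%N by rewrite index_mem.
by rewrite sum_delta // nth_index.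
Qed.

Lemma mcoeff0_ideal : is_ideal (fun p : R => p@_0%MM = 0).
Proof.
split=> [|x y x0 y0|x y y0]; first by rewrite mcoeff0.
  by rewrite mcoeffD x0 y0 addr0.
by rewrite rmorphM /= y0 mulr0.
Qed.

Lemma pihomogM d e (p h : R) : h \is e.-homog ->
  pihomog mdeg d (p * h) = if (e <= d)%N then pihomog mdeg (d - e) p * h else 0.
Proof.
move=> he; have le_p : (msize p <= msize p + d.+1)%N by apply: leq_addr.
rewrite {1}(pihomog_partitionE le_p) mulr_suml raddf_sum /=.
have homo b : pihomog mdeg b p * h \is (b + e).-homog.
  by apply: dhomogM => //; apply: pihomogP.
have zero b : (b + e)%N != d -> pihomog mdeg d (pihomog mdeg b p * h) = 0.
  by move=> neq; rewrite (pihomog_ne0 neq (homo b)).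
case: ifP => [le_ed|/negbT]; last first.
  by rewrite -ltnNge => lt_de; rewrite big1 // => b _; rewrite zero //; lia.
have lt_p : (d - e < msize p + d.+1)%N by lia.
rewrite (bigD1 (Ordinal lt_p)) //= big1 ?addr0 => [|b]; last first.
  by rewrite -val_eqE /= => neq; rewrite zero //; lia.
rewrite pihomog_dE //; have := homo (d - e)%N; by rewrite subnK.
Qed.

Lemma pihomog_mcoeff0 d (p : R) : (0 < d)%N -> (pihomog mdeg d p)@_0%MM = 0.
Proof.
move=> d0; apply: (dhomog_nemf_coeff (pihomogP mdeg d p)).
by rewrite /= mdeg0 eq_sym -lt0n.
Qed.

Lemma pihomog0_const (p : R) : pihomog mdeg 0 p = (p@_0%MM)%:MP.
Proof.
apply/mpolyP => mm; rewrite mcoeffC; have [->|mm0] := eqVneq mm 0%MM; last first.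
  rewrite mulr0; apply: (dhomog_nemf_coeff (pihomogP mdeg 0 p)).
  by rewrite mdeg_eq0.
rewrite mulr1 {2}(pihomog_partitionE (leqW (leqnn (msize p)))).
rewrite big_ord_recl /= mcoeffD [X in _ + X]raddf_sum big1 ?addr0 // => i _.
by rewrite /= pihomog_mcoeff0.
Qed.

Definition homogeneous G := forall g, g \in G -> exists d, g \is d.-homog.

Lemma nth_homog G : homogeneous G -> exists e : nat -> nat,
  forall i, G`_i \is (e i).-homog.
Proof.
move=> hG; apply: (choice (fun i d => G`_i \is d.-homog)) => i.
have [lt_i|le_i] := ltnP i (size G); first exact/hG/mem_nth.
by exists 0%N; rewrite nth_default //; apply: dhomog0.
Qed.

(** In a combination of [G] for a form of degree [d], the homogeneous components
    of the coefficients in the right degrees suffice, and those have a constant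
    term only at the generators of degree [d]. *)
Lemma homog_span G d x : homogeneous G -> x \is d.-homog -> ideal_span G x ->
  exists2 r : nat -> R, x = \sum_(i < size G) r i * G`_i &
    forall i, (r i)@_0%MM != 0 -> G`_i \is d.-homog.
Proof.
move=> /nth_homog[e Ge] hx /ideal_spanE[r xE].
exists (fun i => if (e i <= d)%N then pihomog mdeg (d - e i) (r i) else 0).
  rewrite -(pihomog_dE hx) xE raddf_sum; apply: eq_bigr => i _.
  by rewrite /= (pihomogM _ _ (Ge i)); case: ifP; rewrite ?mul0r.
move=> i; case: ifP => [le_ed|_]; last by rewrite mcoeff0 eqxx.
have [->|neq] := eqVneq d (e i); first by rewrite Ge.
by rewrite pihomog_mcoeff0 ?eqxx // subn_gt0 ltn_neqAle eq_sym neq.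
Qed.

(** Minimality of a generating set in the form used by Nakayama's lemma: no relation
    has a coefficient with a nonzero constant term. *)
Definition nonunit_relations G := forall r,
  \sum_(i < size G) r i * G`_i = 0 ->
  forall i, (i < size G)%N -> (r i)@_0%MM = 0.

(** Write each set of generators in terms of the other one, with homogeneous
    coefficients in the first case. The constant terms in degree [d] form
    matrices [MA] and [MB]; the entries of [MA *m MB - 1] are constant terms of
    relations of [G], so [MA *m MB = 1], which bounds the number of rows of [MA]
    by the number of its columns. *)
Lemma leq_count_homog G H d : homogeneous G -> homogeneous H ->
  nonunit_relations G ->
  (forall g, g \in G -> ideal_span H g) ->
  (forall h, h \in H -> ideal_span G h) ->
  (count (fun g => g \is d.-homog) G <= count (fun g => g \is d.-homog) H)%N.
Proof.
move=> hG hH relG GH HG.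
have count_card (L : seq R) : count (fun g => g \is d.-homog) L =
    #|[set i : 'I_(size L) | L`_i \is d.-homog]|.
  rewrite -sum1_card -sum1_count (big_nth 0) big_mkord.
  by apply: eq_bigl => i; rewrite inE.
rewrite !count_card; set X := [set _ | _]; set Y := [set _ | _].
have [A AE] : exists A : 'I_(size G) -> nat -> R, forall i, i \in X ->
    G`_i = \sum_(a < size H) A i a * H`_a /\
    forall a, (A i a)@_0%MM != 0 -> H`_a \is d.-homog.
  apply: (choice (fun i r => i \in X -> G`_i = \sum_(a < size H) r a * H`_a /\
    forall a, (r a)@_0%MM != 0 -> H`_a \is d.-homog)) => i.
  have [iX|iX] := boolP (i \in X); last by exists (fun => 0).
  have [||r rE r0] := @homog_span H d G`_i hH; last by exists r.
    by rewrite inE in iX.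
  exact/GH/mem_nth.
have [B BE] : exists B : 'I_(size H) -> nat -> R, forall a : 'I_(size H),
    H`_a = \sum_(j < size G) B a j * G`_j.
  apply: (choice (fun (a : 'I_(size H)) (r : nat -> R) =>
    H`_a = \sum_(j < size G) r j * G`_j)) => a.
  by apply/ideal_spanE/HG/mem_nth.
pose MA := \matrix_(i < #|X|, a < #|Y|) (A (enum_val i) (enum_val a))@_0%MM.
pose MB := \matrix_(a < #|Y|, j < #|X|) (B (enum_val a) (enum_val j))@_0%MM.
apply: (@mulmx1_min _ _ _ MA MB).
apply/matrixP => i j; rewrite !mxE.
have iX := enum_valP i; set i' := enum_val i in iX *.
have [GE A0] := AE _ iX.
have rel : \sum_(l < size G) ((l == i' :> nat)%:R -
    \sum_(a < size H) A i' a * B a l) * G`_l = 0.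
  rewrite (eq_bigr _ (fun l _ => mulrBl _ _ _)) sumrB.
  rewrite sum_delta // {1}GE; apply/eqP; rewrite subr_eq0; apply/eqP.
  under [in RHS]eq_bigr do rewrite mulr_suml.
  rewrite exchange_big /=.
  apply: eq_bigr => a _; rewrite {1}BE mulr_sumr; apply: eq_bigr => l _.
  by rewrite mulrA.
pose rr (l : nat) : R := (l == i')%:R - \sum_(a < size H) A i' a * B a l.
have := relG rr rel (enum_val j) (ltn_ord _).
rewrite /rr mcoeffB raddf_sum /= => /eqP; rewrite subr_eq0 => /eqP E.
transitivity (\sum_(a < size H) (A i' a * B a (enum_val j))@_0%MM).
  rewrite (bigID (mem Y)) /= [X in _ + X]big1 ?addr0; last first.
    move=> a aY; rewrite rmorphM /=.
    suff -> : (A i' a)@_0%MM = 0 by rewrite mul0r.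
    by apply/eqP; apply: contraNT aY => /A0; rewrite inE.
  rewrite [RHS]big_enum_val /=; apply: eq_bigr => a _.
  by rewrite !mxE rmorphM.
rewrite -E -[_ == i' :> nat]/(enum_val j == i') (inj_eq enum_val_inj) eq_sym.
by case: eqP => _; rewrite ?mcoeff1 ?eqxx ?mcoeff0.
Qed.

Lemma nonunit_relations_minimal (I : R -> Prop) G :
  homogeneous G -> (forall f, I f <-> ideal_span G f) -> nonunit_relations G ->
  minimal_generators I G.
Proof.
move=> hG IG relG; split=> // G' sub IG'.
have G_uniq : uniq G.
  apply/(uniqP 0) => i j iG jG Eij; apply/eqP; apply: contraT => neq.
  rewrite !inE in iG jG.
  pose q (l : nat) : R := (l == i)%:R - (l == j)%:R.
  have rel : \sum_(l < size G) q l * G`_l = 0.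
    rewrite (eq_bigr _ (fun l _ => mulrBl _ _ _)) sumrB !sum_delta //.
    by rewrite Eij subrr.
  have /eqP := relG q rel i iG.
  by rewrite /q eqxx (negbTE neq) subr0 mcoeff1 eqxx oner_eq0.
have [szG|szG] := leqP (size G) (size G').
  by apply/eqP; rewrite -(size_subseq_leqif sub) eqn_leq szG size_subseq.
have [x xG xG'] : exists2 x, x \in G & x \notin G'.
  apply: NNPP => H; move: szG; rewrite ltnNge; case/negP.
  apply: uniq_leq_size => // x xG; apply: NNPP => /negP xG'.
  by apply: H; exists x.
pose J y := exists2 r : nat -> R,
  y = \sum_(i < size G) r i * G`_i & r (index x G) = 0.
have [r xE rx] : J x.
  have : ideal_span G' x by apply/IG'/IG/ideal_span_mem.
  apply: ideal_gen_min => [|y yG']; first split.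
  - by exists (fun => 0) => //; rewrite big1 // => i _; rewrite mul0r.
  - move=> y z [r -> r0] [q -> q0]; exists (fun i => r i + q i).
      by rewrite -big_split; apply: eq_bigr => i _; rewrite mulrDl.
    by rewrite r0 q0 addr0.
  - move=> y z [r -> r0]; exists (fun i => y * r i).
      by rewrite mulr_sumr; apply: eq_bigr => i _; rewrite mulrA.
    by rewrite r0 mulr0.
  have yG := mem_subseq sub yG'.
  have iG : (index y G < size G)%N by rewrite index_mem.
  exists (fun i => (i == index y G)%:R).
    by rewrite sum_delta // nth_index.
  case: eqP => // /(congr1 (nth 0 G)); rewrite !nth_index // => E.
  by rewrite E yG' in xG'.
have iG : (index x G < size G)%N by rewrite index_mem.
pose q (i : nat) := r i - (i == index x G)%:R.
have rel : \sum_(i < size G) q i * G`_i = 0.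
  rewrite (eq_bigr _ (fun l _ => mulrBl _ _ _)) sumrB -xE sum_delta //.
  by rewrite nth_index // subrr.
have /eqP := relG q rel _ iG.
by rewrite /q rx eqxx sub0r mcoeffN mcoeff1 eqxx oppr_eq0 oner_eq0.
Qed.

(** In the component of a relation of degree [deg G_i], the coefficient of [G_i] is
    the constant term of the original one; if it is nonzero, [G_i] is in the span
    of the others and can be dropped. *)
Lemma minimal_nonunit_relations (I : R -> Prop) G :
  minimal_generators I G -> nonunit_relations G.
Proof.
case=> hG IG minG r rel i lt_i; apply/eqP; apply: contraT => ri0.
pose G' := take i G ++ drop i.+1 G.
have sub : subseq G' G.
  rewrite -[X in subseq _ X](cat_take_drop i G) (drop_nth 0 lt_i).
  by apply: cat_subseq => //; apply: subseq_cons.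
have G'_mem j : (j < size G)%N -> j != i -> G`_j \in G'.
  move=> lt_j ji; rewrite mem_cat; have [lt_ji|le_ij] := ltnP j i.
    by rewrite -(nth_take 0 lt_ji) mem_nth ?size_takel // ltnW.
  apply/orP; right; have lt_ij : (i < j)%N by rewrite ltn_neqAle eq_sym ji.
  rewrite -(subnKC lt_ij) -nth_drop mem_nth // size_drop.
  by rewrite ltn_sub2r // (leq_ltn_trans _ lt_j).
suff Gi : ideal_span G' G`_i.
  have /(congr1 size) : G' = G.
    apply: minG => // f; rewrite IG; split; last first.
      apply: ideal_gen_mono => g gG'; apply: ideal_span_mem.
      exact: mem_subseq gG'.
    apply: ideal_gen_mono => g gG; rewrite -/(ideal_span _ _).
    have lt_g : (index g G < size G)%N by rewrite index_mem.
    rewrite -(nth_index 0 gG).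
    have [->//|neq] := eqVneq (index g G) i.
    exact/ideal_span_mem/G'_mem.
  by rewrite size_cat size_takel ?size_drop 1?ltnW //; lia.
have [e Ge] := nth_homog hG.
have /(congr1 (pihomog mdeg (e i))) := rel.
rewrite raddf0 raddf_sum (bigD1 (Ordinal lt_i)) //= (pihomogM _ _ (Ge i)).
rewrite leqnn subnn pihomog0_const => /eqP; rewrite addr_eq0 => /eqP GiE.
move: ri0 GiE; set a := (r i)@_0%MM => a0 GiE.
have -> : G`_i = (a^-1)%:MP * (a%:MP * G`_i).
  by rewrite mulrA -rmorphM mulVf // rmorph1 mul1r.
rewrite GiE; apply: is_idealM => //; apply: is_idealN => //.
apply: is_ideal_sum => // j; rewrite -val_eqE /= => ji.
rewrite (pihomogM _ _ (Ge j)); case: ifP => _; last exact: is_ideal0.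
by apply: is_idealM => //; apply/ideal_span_mem/G'_mem.
Qed.

Lemma nonunit_relations_neq0 G g :
  nonunit_relations G -> g \in G -> g != 0.
Proof.
move=> relG gG; have iG : (index g G < size G)%N by rewrite index_mem.
apply/eqP => g0; have := relG (fun i => (i == index g G)%:R).
rewrite sum_delta // nth_index // => /(_ g0 _ iG) /eqP.
by rewrite eqxx mcoeff1 eqxx oner_eq0.
Qed.

End Nakayama.

(** * Counting minimal exponents *)

Section Counting.
Local Open Scope nat_scope.
Implicit Types (b l : seq nat).

(** The subsets of [1, ..., p], listed downwards: chains are split off from their
    largest member, which is then the head. *)
Fixpoint decreasing_seqs p : seq (seq nat) :=
  if p is q.+1 then decreasing_seqs q ++ [seq p :: b | b <- decreasing_seqs q]
  else [:: [::]].

Lemma mem_decreasing_seqs p b :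
  (b \in decreasing_seqs p) =
  sorted (fun x y => y < x) b && all (fun x => 0 < x <= p) b.
Proof.
have gt_trans : transitive (fun x y => y < x).
  by move=> y x z /[swap]; apply: ltn_trans.
elim: p b => [|p IH] [|x b] //=.
- by rewrite inE; case: x => [|x] /=; rewrite ?andbF.
- by rewrite mem_cat IH.
rewrite mem_cat IH /= !(path_sortedE gt_trans).
apply/orP/andP => [[/and3P[/andP[xb b_sorted] /andP[x0 xp] bp]|]|].
- rewrite xb b_sorted x0 (leqW xp); split=> //=.
  by apply: sub_all bp => y /andP[-> /leqW].
- case/mapP => b0; rewrite IH => /andP[b_sorted bp] [-> ->].
  rewrite b_sorted ltnSn; split; rewrite //= ?andbT.
    by apply: sub_all bp => y /andP[_]; rewrite ltnS.
  by apply: sub_all bp => y /andP[-> /leqW].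
case=> /andP[xb b_sorted] /andP[/andP[x0 xp] /allP bp].
have bx q : x <= q.+1 -> all (fun y => 0 < y <= q) b.
  move=> xq; apply/allP => y yb; have /andP[-> _] := bp y yb.
  by rewrite -ltnS; apply: leq_trans xq; apply: (allP xb).
move: xp; rewrite leq_eqVlt => /predU1P[xE|xp].
  right; rewrite xE; apply: map_f; rewrite IH b_sorted /=; apply: bx.
  by rewrite xE.
by left; rewrite xb b_sorted x0 -ltnS xp bx // ltnW.
Qed.

Lemma decreasing_seqs_uniq p : uniq (decreasing_seqs p).
Proof.
elim: p => //= p IH; rewrite cat_uniq IH map_inj_uniq ?IH ?andbT; last first.
  by move=> ? ? [].
apply/hasPn => _ /mapP[b _ ->]; rewrite mem_decreasing_seqs /=.
by rewrite ltnn andbF.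
Qed.

Lemma big_decreasing_seqs p (f : seq nat -> nat) :
  \sum_(b <- decreasing_seqs p) f b =
  f [::] + \sum_(x < p) \sum_(b <- decreasing_seqs x) f (x.+1 :: b).
Proof.
elim: p => [|p IH] /=; first by rewrite big_seq1 big_ord0 addn0.
by rewrite big_cat IH big_map big_ord_recr /= addnA.
Qed.

Lemma sorted_elements c (B : {set 'I_c}) : sorted ltn (elements B).
Proof.
rewrite sorted_map (eq_sorted (e' := relpre val ltn)) //.
rewrite /enum_mem; apply: sorted_filter.
  by move=> ? ? ?; apply: ltn_trans.
by rewrite -enumT -sorted_map val_enum_ord iota_ltn_sorted.
Qed.

Lemma mem_elements c (B : {set 'I_c}) (i : 'I_c) :
  (i.+1 \in elements B) = (i \in B).
Proof.
by rewrite (mem_map (f := fun i : 'I_c => i.+1)) ?mem_enum // => ? ? [/val_inj].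
Qed.

Lemma sum_elements c (f : seq nat -> nat) :
  \sum_(B : {set 'I_c}) f (rev (elements B)) =
  \sum_(b <- decreasing_seqs c) f b.
Proof.
rewrite -(big_map (fun B : {set 'I_c} => rev (elements B)) predT f).
have elts_inj : injective (fun B : {set 'I_c} => rev (elements B)).
  move=> B B' /(can_inj revK) E; apply/setP => i.
  by rewrite -!mem_elements E.
apply: perm_big; apply: uniq_perm.
- by rewrite map_inj_uniq // index_enum_uniq.
- exact: decreasing_seqs_uniq.
move=> b; rewrite mem_decreasing_seqs.
apply/mapP/andP => [[B _ ->]|[b_sorted /allP bc]].
  rewrite rev_sorted sorted_elements all_rev; split=> //.
  by apply/allP => _ /mapP[i _ ->] /=.
exists [set i : 'I_c | i.+1 \in b]; first by rewrite mem_index_enum.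
apply: (irr_sorted_eq (leT := fun x y => y < x)).
- by move=> y x z /[swap]; apply: ltn_trans.
- by move=> x; apply: ltnn.
- exact: b_sorted.
- by rewrite rev_sorted sorted_elements.
move=> x; rewrite mem_rev; apply/idP/mapP => [xb|[i]]; last first.
  by rewrite mem_enum inE => ? ->.
have /andP[x0 xc] := bc x xb.
have xc' : x.-1 < c by rewrite prednK.
by exists (Ordinal xc'); rewrite ?mem_enum ?inE /= prednK.
Qed.

(** The number of positive solutions, as a sum over the value [y] of the first
    unknown. *)
Fixpoint solutions b t m : nat :=
  if b is x :: l then
    \sum_(1 <= y < t.+1 | x * y <= m) solutions l (t - y) (m - x * y)
  else (t == 0) && (m == 0).

Definition tuple_solutions K n b t m :=
  [set x : n.-tuple 'I_K | [&& [forall i, 0 < tnth x i],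
    \sum_(i < n) nth 0 b i * tnth x i == m & \sum_(i < n) tnth x i == t]].

Lemma tuple_solutions_rev K n b t m : size b = n ->
  #|tuple_solutions K n (rev b) t m| = #|tuple_solutions K n b t m|.
Proof.
move=> bn; pose revt (x : n.-tuple 'I_K) : n.-tuple 'I_K := [tuple of rev x].
have revtK : involutive revt by move=> x; apply: val_inj; rewrite /= revK.
have tnth_revt x i : tnth (revt x) i = tnth x (rev_ord i).
  have x0 := tnth x i.
  by rewrite [LHS](tnth_nth x0) [RHS](tnth_nth x0) /= nth_rev size_tuple.
rewrite -!sum1_card (reindex_inj (inv_inj revtK)); apply: eq_bigl => x.
rewrite !inE; congr [&& _, _ & _].
- apply/forallP/forallP => H i; last by rewrite tnth_revt.
  by rewrite -(rev_ordK i) -tnth_revt.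
- congr (_ == _); rewrite [RHS](reindex_inj rev_ord_inj) /=.
  by apply: eq_bigr => i _; rewrite tnth_revt nth_rev ?bn.
- congr (_ == _); rewrite [RHS](reindex_inj rev_ord_inj) /=.
  by apply: eq_bigr => i _; rewrite tnth_revt.
Qed.

(** The bound [K] is fixed throughout the recursion, whereas the sum [t] drops. *)
Lemma card_tuple_solutions K n b t m : size b = n -> t < K ->
  #|tuple_solutions K n b t m| = solutions b t m.
Proof.
elim: n b t m => [|n IH] [|x l] t m //=.
  move=> _ _; rewrite -[RHS]muln1 -(cards1 ([tuple] : 0.-tuple 'I_K)).
  case: (boolP ((t == 0) && (m == 0))) => [/andP[/eqP-> /eqP->]|neq].
    rewrite mul1n; apply: eq_card => z; rewrite [z]tuple0 !inE !big_ord0 /=.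
    by rewrite andbT; transitivity true; [apply/forallP; case|exact/esym/eqP].
  rewrite mul0n; apply: eq_card0 => z; rewrite !inE !big_ord0.
  by apply: contraNF neq => /and3P[_ /eqP<- /eqP<-].
move=> [ln] tK.
pose h (p : 'I_K * n.-tuple 'I_K) : n.+1.-tuple 'I_K := [tuple of p.1 :: p.2].
have h_bij : bijective h.
  exists (fun z => (thead z, [tuple of behead z])) => [[y z]|z].
    by congr pair; apply: val_inj.
  by rewrite [RHS]tuple_eta.
rewrite -sum1_card big_mkcond (reindex h) /=; last exact: onW_bij.
rewrite -(pair_big predT predT
  (fun y z =>
     if h (y, z) \in tuple_solutions K n.+1 (x :: l) t m then 1 else 0)) /=.
rewrite big_geq_mkord (big_ord_widen_cond K (fun y => (x * y <= m) && (0 < y))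
  (fun y => solutions l (t - y) (m - x * y))) // [RHS]big_mkcond.
apply: eq_bigr => y _; rewrite -big_mkcond sum1_card.
have memE z : (h (y, z) \in tuple_solutions K n.+1 (x :: l) t m) =
    [&& x * y <= m, 0 < y, y < t.+1 &
      z \in tuple_solutions K n l (t - y) (m - x * y)].
  have addn_eq u v w : (u + v == w) = (u <= w) && (v == w - u).
    by apply/idP/idP => [/eqP|/andP[uw /eqP]]; [case: leqP|]; lia.
  have h0 : tnth (h (y, z)) ord0 = y by [].
  have hS i : tnth (h (y, z)) (lift ord0 i) = tnth z i by rewrite tnthS.
  have -> : (h (y, z) \in tuple_solutions K n.+1 (x :: l) t m) =
      [&& (0 < y) && [forall i, 0 < tnth z i],
          x * y + \sum_(i < n) nth 0 l i * tnth z i == m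
        & y + \sum_(i < n) tnth z i == t].
    rewrite inE; congr [&& _, _ & _].
    - apply/forallP/andP => [H|[y0 /forallP H] i].
        by split; [rewrite -h0|apply/forallP => i; rewrite -hS].
      by case: (unliftP ord0 i) => [j|] ->; rewrite ?hS ?h0.
    - by rewrite big_ord_recl h0; under eq_bigr do rewrite hS.
    - by rewrite big_ord_recl h0; under eq_bigr do rewrite hS.
  rewrite !addn_eq inE ltnS.
  by case: (x * y <= m); case: (0 < y); case: (y <= t) => //=; rewrite ?andbF.
case: ifP => [/andP[/andP[xy y0] yt]|y_out].
  rewrite -IH //; last by apply: leq_ltn_trans tK; apply: leq_subr.
  by apply: eq_card => z; rewrite [LHS]memE xy y0 yt.
apply: eq_card0 => z; rewrite [LHS]memE.
by apply: contraFF y_out => /and4P[-> -> ->].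
Qed.

Lemma solutions0 b m : solutions b 0 m = (b == [::]) && (m == 0) :> nat.
Proof. by case: b => [|x b] //=; rewrite big_nil. Qed.

(** Either the unknown attached to [x] is at least 2 and can be lowered, or it is 1
    and can be removed. *)
Lemma solutionsS x b t m : solutions (x :: b) t.+1 m =
  if x <= m then solutions (x :: b) t (m - x) + solutions b t (m - x) else 0.
Proof.
rewrite /= big_mkcond big_ltn // muln1 subn1 big_add1 /=.
case: ifP => [xm|/negbT xm]; last first.
  rewrite big1 // => y _; case: ifP => //; rewrite mulnS => H.
  by move: xm; rewrite (leq_trans _ H) // leq_addr.
rewrite addnC; congr (_ + _).
rewrite [RHS]big_mkcond /=; apply: eq_bigr => y _.
by rewrite mulnS subnDA subSS leq_subRL.
Qed.

#[global] Arguments solutions : simpl never.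

(** The number of chains of sets of sizes [r + x] inside a fixed set, for [x]
    running through [b], where the head of [b] gives the size of the fixed set. *)
Fixpoint chain_product r b : nat :=
  if b is y :: (x :: _) as l then 'C(r + y, y - x) * chain_product r l else 1.

#[global] Arguments chain_product : simpl never.

Section Chains.
Variable r : nat.

Lemma chain_product_cons2 y x l :
  chain_product r [:: y, x & l] = 'C(r + y, y - x) * chain_product r (x :: l).
Proof. by []. Qed.

(** Putting [p] in front of [b] accounts for the choice of the largest set inside a
    set of size [r + p]. *)
Definition chain_count p t m :=
  \sum_(b <- decreasing_seqs p) solutions b t m * chain_product r (p :: b).

Lemma chain_count0 p m : chain_count p 0 m = (m == 0).
Proof.
rewrite /chain_count big_decreasing_seqs big1 => [|x _].
  by rewrite solutions0 eqxx /= muln1 addn0.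
by rewrite big1 // => b _; rewrite solutions0.
Qed.

(** Split by the largest element [x.+1] of [b], which gives the size of the first
    set of the chain. The two terms of [solutionsS] are the sequences that keep
    [x.+1] and those that drop it: the next set of the chain is the same one, with
    one choice, or a smaller one. *)
Lemma chain_countS p t m : chain_count p t.+1 m =
  \sum_(x < p | x < m) 'C(r + p, p - x.+1) * chain_count x.+1 t (m - x.+1).
Proof.
rewrite /chain_count big_decreasing_seqs mul0n add0n [RHS]big_mkcond /=.
apply: eq_bigr => x _; case: ifP => xm; last first.
  by rewrite big1 // => b _; rewrite solutionsS xm mul0n.
rewrite big_cat big_map /= -big_split big_distrr /=; apply: eq_bigr => b _.
rewrite solutionsS xm !chain_product_cons2 subnn bin0 mul1n.
by rewrite -mulnDl addnC mulnCA.
Qed.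

(** The minimal exponents supported in [U]; with [U] varying they are closed under
    removing the first level. *)
Definition level_exponents s K t m (U : {set 'I_s}) :=
  [set a : {ffun 'I_s -> 'I_K} | [&&
    [forall j, a j <= (if j \in U then t else 0)],
    r < #|[set j in U | a j == t :> nat]| & \sum_j a j == t * r + m]].

(** Sort the exponents by their support [S], of size [r + x]. Subtracting 1 on [S]
    identifies those with the exponents supported in [S] for [t - 1] and [m - x]. *)
Lemma card_level_exponents s K t m (U : {set 'I_s}) : t < K -> r < #|U| ->
  #|level_exponents K t m U| = chain_count (#|U| - r) t m.
Proof.
case: K => // K; elim: t m U => [|t IH] m U tK rU.
  rewrite chain_count0; case: (eqVneq m 0) => [->|m0]; last first.
    apply: eq_card0 => a; rewrite inE; apply/negP => /and3P[/forallP a0 _ /eqP].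
    rewrite big1 ?mul0n ?add0n => [E|j _]; first by rewrite -E eqxx in m0.
    by apply/eqP; have := a0 j; rewrite if_same leqn0.
  rewrite [RHS]/= -[RHS](cards1 ([ffun => ord0] : {ffun 'I_s -> 'I_K.+1})).
  apply: eq_card => a; rewrite !inE; apply/and3P/eqP => [[/forallP a0 _ _]|->].
    apply/ffunP => j; apply: val_inj; rewrite ffunE /=; apply/eqP.
    by have := a0 j; rewrite if_same leqn0.
  split; first by apply/forallP => j; rewrite ffunE.
    rewrite (eq_card (B := mem U)) // => j.
    by rewrite !inE ffunE eqxx andbT.
  by rewrite big1 // => j _; rewrite ffunE.
pose supp (a : {ffun 'I_s -> 'I_K.+1}) := [set j | 0 < a j].
rewrite -sum1_card (partition_big supp predT) //=.
have fiber (S : {set 'I_s}) :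
    \sum_(a in level_exponents K.+1 t.+1 m U | supp a == S) 1 =
    if [&& S \subset U, r < #|S| & #|S| - r <= m]
    then chain_count (#|S| - r) t (m - (#|S| - r)) else 0.
  have -> : \sum_(a in level_exponents K.+1 t.+1 m U | supp a == S) 1 =
      #|[set a in level_exponents K.+1 t.+1 m U | supp a == S]|.
    by rewrite -sum1_card; apply: eq_bigl => a; rewrite [RHS]inE.
  have suppE a j : supp a = S -> (j \in S) = (0 < a j).
    by move=> <-; rewrite inE.
  have predE (a : {ffun 'I_s -> 'I_K.+1}) j :
      supp a = S -> (a j).-1 + (j \in S) = a j.
    move=> aS; rewrite (suppE a) //.
    by case: (a j : nat) => // u; rewrite addn1.
  have top a : supp a = S -> a \in level_exponents K.+1 t.+1 m U ->
      [set j in U | a j == t.+1 :> nat] = [set j in S | (a j).-1 == t].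
    move=> aS; rewrite inE => /and3P[/forallP aU _ _].
    apply/setP => j; rewrite !inE (suppE a) //.
    have := aU j; case: (j \in U); case: (a j : nat) => //= u.
  case: ifP => [/and3P[SU rS Sm]|cond]; last first.
    apply: eq_card0 => a; apply: contraFF cond.
    rewrite inE => /andP[aL /eqP aS].
    have topE := top a aS aL; move: aL; rewrite inE topE.
    case/and3P=> /forallP aU a_top /eqP a_sum.
    have SU : S \subset U.
      apply/subsetP => j; rewrite (suppE a) // lt0n; apply: contraNT => jU.
      by have := aU j; rewrite (negbTE jU) leqn0.
    have rS : r < #|S|.
      apply: leq_trans a_top _; apply: subset_leq_card.
      by apply/subsetP => j; rewrite inE => /andP[].
    rewrite SU rS /=.
    have : \sum_(j in S) 1 + \sum_(j in [set j in S | (a j).-1 == t]) t <=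
        \sum_j a j.
      rewrite big_mkcond [X in _ + X]big_mkcond -big_split /=.
      apply: leq_sum => j _.
      rewrite inE; have := predE a j aS; case: (j \in S) => //=.
      by case: eqP => /=; lia.
    rewrite a_sum sum1_card sum_nat_const mulSn.
    have : r.+1 * t <= #|[set j in S | (a j).-1 == t]| * t.
      by rewrite leq_mul2r a_top orbT.
    rewrite mulSn [t * r]mulnC; move: (#|[set j in S | _]| * t) (r * t) => C D.
    by rewrite leq_subLR; move: #|S| => u; lia.
  rewrite -IH //; last exact: ltnW.
  pose g (b : {ffun 'I_s -> 'I_K.+1}) : {ffun 'I_s -> 'I_K.+1} :=
    [ffun j => inord (b j + (j \in S))].
  have gE (b : {ffun 'I_s -> 'I_K.+1}) j :
      b \in level_exponents K.+1 t (m - (#|S| - r)) S ->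
      g b j = b j + (j \in S) :> nat.
    rewrite inE ffunE => /and3P[/forallP/(_ j) bj _ _]; rewrite inordK //.
    by apply: leq_ltn_trans tK; case: (j \in S) bj; lia.
  have g_inj : {in level_exponents K.+1 t (m - (#|S| - r)) S &, injective g}.
    move=> b b' bY b'Y gbb'; apply/ffunP => j; apply: val_inj => /=.
    by apply: (@addIn (j \in S)); rewrite -!gE // gbb'.
  rewrite -(card_in_imset g_inj); apply: eq_card => a.
  apply/idP/imsetP => [|[b bY ->]].
    rewrite inE => /andP[aL /eqP aS]; have topE := top a aS aL.
    pose f : {ffun 'I_s -> 'I_K.+1} := [ffun j => inord (a j).-1].
    have fE j : f j = (a j).-1 :> nat.
      rewrite ffunE inordK //; apply: leq_ltn_trans (ltn_ord (a j)).
      exact: leq_pred.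
    move: aL; rewrite inE topE => /and3P[/forallP aU a_top /eqP a_sum].
    exists f; last first.
      apply/ffunP => j; apply: val_inj; rewrite ffunE /= fE predE // inordK //.
    rewrite inE; apply/and3P; split.
    - apply/forallP => j; rewrite fE (suppE a) //.
      have := aU j; case: (a j : nat) => // u; rewrite /=.
      by case: (j \in U).
    - apply: leq_trans a_top _; apply: subset_leq_card; apply/subsetP => j.
      by rewrite !inE fE.
    - rewrite (eq_bigr (fun j => (a j).-1)) => [|j _]; last by rewrite fE.
      have : \sum_j a j = \sum_j (a j).-1 + #|S|.
        rewrite -sum1_card [X in _ + X]big_mkcond -big_split /=.
        by apply: eq_bigr => j _; rewrite -{1}(predE a j aS); case: (j \in S).
      have shift_sum q u : r < q -> q - r <= m -> r + t * r + m = u + q ->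
          u = t * r + (m - (q - r)) by lia.
      by rewrite a_sum mulSn => E; apply/eqP; apply: shift_sum E.
  have gbE := fun j => gE b j bY; move: bY; rewrite !inE.
  case/and3P=> /forallP bS b_top /eqP b_sum; apply/andP; split; last first.
    apply/eqP/setP => j; rewrite inE gbE; have := bS j.
    by case: (j \in S); rewrite ?addn1 // addn0 leqn0 => /eqP->.
  apply/and3P; split.
  - apply/forallP => j; rewrite gbE; have := bS j.
    case: (boolP (j \in S)) => [jS|_]; rewrite ?addn0; last first.
      by rewrite leqn0 => /eqP->.
    by rewrite (subsetP SU _ jS) addn1.
  - apply: leq_trans b_top _; apply: subset_leq_card; apply/subsetP => j.
    rewrite !inE gbE => /andP[jS /eqP->]; rewrite jS (subsetP SU _ jS) addn1.
    exact: eqxx.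
  - rewrite (eq_bigr _ (fun j _ => gbE j)) big_split /= b_sum.
    rewrite -big_mkcond sum1_card.
    have shift_sum q : r < q -> q - r <= m ->
        t * r + (m - (q - r)) + q = r + t * r + m by lia.
    by rewrite mulSn; apply/eqP; apply: shift_sum.
rewrite (eq_bigr _ (fun S _ => fiber S)) chain_countS.
have -> : \sum_(x < #|U| - r | x < m) 'C(r + (#|U| - r), #|U| - r - x.+1) *
      chain_count x.+1 t (m - x.+1) =
    \sum_(x < #|U| - r) \sum_(S : {set 'I_s}) 
      if [&& x < m, S \subset U & #|S| == r + x.+1]
      then chain_count x.+1 t (m - x.+1) else 0.
  rewrite big_mkcond /=; apply: eq_bigr => x _.
  case: ifP => xm; last by rewrite big1.
  rewrite -big_mkcond sum_nat_const; congr (_ * _).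
  have rxU : r + x.+1 <= #|U| by rewrite addnS -ltn_subRL ltn_ord.
  rewrite subnKC 1?ltnW // -subnDA.
  rewrite bin_sub // -cards_draws; apply: eq_card => S.
  by rewrite [LHS]inE.
rewrite exchange_big /=; apply: eq_bigr => S _.
case: ifP => [/and3P[SU rS Sm]|cond]; last first.
  rewrite big1 // => x _; case: ifP => // /and3P[xm SU /eqP SE].
  by move: cond; rewrite SU SE addKn xm andbT -addn1 leq_add2l.
have xU : (#|S| - r).-1 < #|U| - r by have := subset_leq_card SU; lia.
(* The only [x] that contributes for [S] is [#|S| - r], with index one less. *)
have SrE : (#|S| - r).-1.+1 = #|S| - r by rewrite prednK // subn_gt0.
rewrite (bigD1 (Ordinal xU)) //= SrE Sm SU subnKC ?(ltnW rS) // eqxx /=.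
rewrite big1 ?addn0 // => x; rewrite -val_eqE /= => neq.
by case: ifP => // /andP[_ /eqP SE]; case/eqP: neq; rewrite SE addKn.
Qed.

End Chains.

End Counting.

(** * The generators of the symbolic powers *)

Lemma chain_product_binomial s c b : b != [::] ->
  (chain_product (s - c) (c :: rev b) =
    'C(s - c + c, c - last 0 b) * \prod_(1 <= i < size b)
      'C(s - c + nth 0 b i, nth 0 b i - nth 0 b i.-1))%N.
Proof.
have aux b' x : chain_product (s - c) (x :: rev b') =
    (\prod_(1 <= i < (size b').+1) 'C(s - c + nth 0 (rcons b' x) i,
       nth 0 (rcons b' x) i - nth 0 (rcons b' x) i.-1))%N.
  elim/last_ind: b' x => [|b' y IH] x; first by rewrite big_geq.
  rewrite rev_rcons chain_product_cons2 IH size_rcons.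
  rewrite [RHS]big_nat_recr //= [RHS]mulnC; congr (_ * _)%N.
    by rewrite !nth_rcons size_rcons !ltnn ltnSn !eqxx.
  apply: eq_big_nat => i /andP[i0 i_lt].
  by rewrite ![nth 0%N (rcons (rcons _ _) _) _]nth_rcons size_rcons i_lt
    (leq_ltn_trans (leq_pred i) i_lt).
case/lastP: b => // b x _.
by rewrite rev_rcons chain_product_cons2 aux last_rcons size_rcons.
Qed.

(** For [t > 0] the empty set has no solution, so it may be added to the sum. *)
Lemma sum_binomial_product s c m t : (c <= s)%N -> (0 < t)%N ->
  (\sum_(B : {set 'I_c} | B != set0)
     #|positive_solutions m t (elements B)|
     * binomial_product s c (elements B))%N =
  chain_count (s - c) c t m.
Proof.
move=> cs t0; rewrite /chain_count -sum_elements [RHS](bigD1 set0) //=.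
have -> : elements (set0 : {set 'I_c}) = [::] by rewrite /elements enum_set0.
have -> : solutions (rev [::]) t m = 0%N by rewrite /solutions /= eqn0Ngt t0.
rewrite mul0n add0n; apply: eq_bigr => B B0.
have eltsB : elements B != [::].
  apply: contraNneq B0 => E; apply/eqP/setP => i.
  by rewrite -mem_elements E inE.
rewrite chain_product_binomial // subnK // /binomial_product; congr (_ * _)%N.
rewrite -(@card_tuple_solutions t.+1 (size (elements B))) ?size_rev //.
by rewrite tuple_solutions_rev.
Qed.

Lemma t_rangeE m c t : (0 < c)%N ->
  t_range m c t <-> (m <= c * t)%N /\ (t <= m)%N.
Proof.
move=> c0; rewrite /t_range.
have -> : (Num.ceil (m%:Q / c%:Q) <= t%:Z) = (m <= c * t)%N; last by [].
rewrite ceil_le_int ler_pdivrMr ?ltr0z // -rmorphM /= ler_int lez_nat mulnC.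
by [].
Qed.

Section Main.
Variables (k : fieldType) (n s c delta m : nat) (F : 'I_s -> {mpoly k[n]}).
Hypotheses (c_ge1 : (1 <= c)%N) (c_lt_s : (c < s)%N).
Hypothesis delta_ge1 : (1 <= delta)%N.
Hypothesis F_form : forall j, F j \is delta.-homog.
Hypothesis F_regular : forall r : seq 'I_s, uniq r -> size r = c.+1 ->
  regular_sequence [seq F j | j <- r].

Let regF := regular_sequence_permutable c_lt_s F_regular.
Local Notation I := (symbolic_power (star_ideal F c) m).
Local Notation G0 := (star_generators c m F).

Lemma monomial_homog a : monomial F a \is (delta * \sum_j a j)%N.-homog.
Proof.
rewrite big_distrr /= /monomial.
apply: (big_ind2 (fun p d => p \is d.-homog)) => [|p d q e hp hq|j _].
- exact: dhomog1.
- exact: dhomogM.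
- exact: dhomogMn.
Qed.

Lemma star_generators_homog : homogeneous G0.
Proof.
move=> _ /mapP[w _ ->]; exists (delta * \sum_j exponent w j)%N.
exact: monomial_homog.
Qed.

Lemma symbolic_span f : I f <-> ideal_span G0 f.
Proof.
rewrite (symbolic_starE (@ex_prime_colon k n) c_lt_s regF).
exact: star_generators_span.
Qed.

Lemma star_generators_relations : nonunit_relations G0.
Proof.
move=> r rel i; rewrite size_map => i_lt.
set M := enum (star_exponents s c m).
have w0 : {ffun 'I_s -> 'I_m.+1} := [ffun => ord0].
have rel' : \sum_(w in star_exponents s c m)
    r (index w M) * monomial F (exponent w) = 0.
  rewrite -[RHS]rel size_map -big_enum /= (big_nth w0) big_mkord.
  apply: eq_bigr => j _; rewrite index_uniq ?enum_uniq // (nth_map w0) //.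
have wM : nth w0 M i \in star_exponents s c m by rewrite -mem_enum mem_nth.
have [J Jc] := star_relation c_lt_s regF rel' wM.
rewrite index_uniq ?enum_uniq //.
apply: (@ideal_gen_min _ _ (fun p : {mpoly k[n]} => p@_0%MM = 0)).
  exact: mcoeff0_ideal.
move=> _ [j _ ->]; rewrite expr1; apply: (dhomog_nemf_coeff (F_form j)).
by rewrite /= mdeg0 eq_sym -lt0n.
Qed.

Lemma star_generators_minimal : minimal_generators I G0.
Proof.
apply: nonunit_relations_minimal.
- exact: star_generators_homog.
- exact: symbolic_span.
- exact: star_generators_relations.
Qed.

(** Both generating sets have only nonunit relations, so the inequality of
    [leq_count_homog] holds in both directions. *)
Lemma count_minimal_generators G d : minimal_generators I G ->
  count (fun g => g \is d.-homog) G = count (fun g => g \is d.-homog) G0.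
Proof.
move=> Gmin; have relG := minimal_nonunit_relations Gmin; case: Gmin => hG IG _.
have rel0 := star_generators_relations; have h0 := star_generators_homog.
have GG0 g : g \in G -> ideal_span G0 g.
  by move=> gG; apply/symbolic_span/IG/ideal_span_mem.
have G0G g : g \in G0 -> ideal_span G g.
  by move=> gG; apply/IG/symbolic_span/ideal_span_mem.
by apply/eqP; rewrite eqn_leq !leq_count_homog.
Qed.

Lemma monomial_homogE t (w : {ffun 'I_s -> 'I_m.+1}) d :
  minimal_exponent c m t (exponent w) ->
  (monomial F (exponent w) \is d.-homog) = (d == delta * (t * (s - c) + m))%N.
Proof.
move=> w_min; have sum_w : (\sum_j exponent w j = t * (s - c) + m)%N.
  by case/and3P: w_min => _ _ /eqP.
have hw := monomial_homog (exponent w); rewrite sum_w in hw.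
apply/idP/eqP => [hd|->//]; apply: dhomog_uniq hd hw.
apply: nonunit_relations_neq0 star_generators_relations _.
by apply: map_f; rewrite mem_enum; apply/star_exponentsP => //; exists t.
Qed.

Lemma minimal_generator_degree G g : minimal_generators I G -> g \in G ->
  exists2 d, (exists2 t, t_range m c t & d = delta * (t * (s - c) + m))%N &
    g \is d.-homog.
Proof.
move=> Gmin gG; case: (Gmin) => hG _ _; have [d gd] := hG g gG.
exists d => //; have : (0 < count (fun g => g \is d.-homog) G)%N.
  by rewrite -has_count; apply/hasP; exists g.
rewrite count_minimal_generators // -has_count => /hasP[_ /mapP[w wM ->]].
move: wM; rewrite mem_enum => /star_exponentsP[]// t w_min.
rewrite (monomial_homogE d w_min) => /eqP->; exists t => //.
exact/t_rangeE/(minimal_exponent_range c_lt_s w_min).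
Qed.

(** The degree of [F^w] determines [t] since [s - c] and [delta] are positive. *)
Lemma count_star_generators t : (t <= m)%N ->
  count (fun g => g \is (delta * (t * (s - c) + m)).-homog) G0 =
  chain_count (s - c) c t m.
Proof.
move=> tm; rewrite count_map -size_filter.
have sc : (s - c < #|[set: 'I_s]|)%N by rewrite cardsT card_ord; lia.
have := @card_level_exponents (s - c) s m.+1 t m setT tm sc.
rewrite cardsT card_ord subKn ?(ltnW c_lt_s) // => <-.
rewrite cardE; apply: perm_size; apply: uniq_perm.
- by rewrite filter_uniq ?enum_uniq.
- exact: enum_uniq.
move=> w; rewrite mem_filter !mem_enum.
have minE : (w \in level_exponents (s - c) m.+1 t m setT) =
    minimal_exponent c m t (exponent w).
  rewrite inE /minimal_exponent; congr [&& _, _ & _].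
    by apply: eq_forallb => j; rewrite inE.
  by congr (_ < _)%N; apply: eq_card => j; rewrite !inE.
rewrite [RHS]minE; apply/andP/idP => [[hw /star_exponentsP[]// t' w_min]|w_min].
  move: hw; rewrite /= (monomial_homogE _ w_min) eqn_pmul2l // eqn_add2r.
  by rewrite eqn_pmul2r ?subn_gt0 // => /eqP->.
split; first by rewrite /= (monomial_homogE _ w_min).
by apply/star_exponentsP => //; exists t.
Qed.

End Main.

Theorem theorem4p12 (k : fieldType) (n s c delta : nat)
    (F : 'I_s -> {mpoly k[n.+1]})
    (c_ge1 : (1 <= c)%N) (c_lt_s : (c < s)%N) (delta_ge1 : (1 <= delta)%N)
    (F_form : forall j, F j \is delta.-homog)
    (F_regular : forall r : seq 'I_s, uniq r -> size r = c.+1 ->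
       regular_sequence [seq F j | j <- r]) :
  (forall m : nat, (1 <= m)%N ->
     generated_in_degrees (symbolic_power (star_ideal F c) m)
       (fun d => exists2 t : nat,
          t_range m c t & d = (delta * (t * (s - c) + m))%N))
  /\
  (forall m t : nat, (1 <= m)%N -> t_range m c t ->
     number_of_generators (symbolic_power (star_ideal F c) m)
       (delta * (t * (s - c) + m))%N
       (\sum_(B : {set 'I_c} | B != set0)
          #|positive_solutions m t (elements B)|
          * binomial_product s c (elements B))%N).
Proof.
have ex_min m := star_generators_minimal m c_ge1 c_lt_s delta_ge1 F_form F_regular.
split=> [m _|m t m_ge1 t_in]; split; try by exists (star_generators c m F).
  move=> G Gmin g gG.
  exact: (minimal_generator_degree c_ge1 c_lt_s delta_ge1 F_form F_regular Gmin).
have [m_le t_le] := (t_rangeE m t c_ge1).1 t_in.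
have t_gt0 : (0 < t)%N.
  by rewrite lt0n; apply: contraTneq m_le => ->; rewrite muln0 -ltnNge.
move=> G Gmin.
rewrite (count_minimal_generators c_ge1 c_lt_s delta_ge1 F_form F_regular _ Gmin).
rewrite (count_star_generators c_ge1 c_lt_s delta_ge1 F_form F_regular t_le).
by rewrite sum_binomial_product // ltnW.
Qed.
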